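(* Let $G$ be a fullerene graph with $n$ vertices. Then $G$ contains a cycle of length at least $5n/6-2/3$.
   Context: A fullerene graph is a $3$-regular (cubic), planar, $3$-connected graph in which every face (of its plane embedding) has size five or six. *)

(* Defs.v *)
From mathcomp Require Import all_boot.
Set Implicit Arguments. Unset Strict Implicit. Unset Printing Implicit Defensive.

Section Fullerene.
Variables (V : finType) (e : rel V).

Definition simple_graph := symmetric e /\ irreflexive e.

Definition nbr (v : V) : {set V} := [set u | e v u].

Definition cubic := forall v : V, #|nbr v| = 3.

Definition connected_avoiding (S : {set V}) :=
  forall x y : V, x \notin S -> y \notin S ->
    connect (fun a b => e a b && (b \notin S)) x y.

Definition three_connected :=
  3 < #|V| /\ forall S : {set V}, #|S| <= 2 -> connected_avoiding S.

Definition darts : {set V * V} := [set d | e d.1 d.2].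
Definition nedges := #|darts| %/ 2.

(* A rotation system: rho v is a cyclic permutation of the neighbours
   of v (a single cycle on nbr v). *)
Definition rotation_system (rho : V -> V -> V) :=
  forall v : V, (forall u, u \in nbr v -> rho v u \in nbr v) /\
    (forall u w, u \in nbr v -> w \in nbr v -> fconnect (rho v) u w).

Definition face_succ (rho : V -> V -> V) (d : V * V) : V * V :=
  (d.2, rho d.2 d.1).

Definition face_of (rho : V -> V -> V) (d : V * V) : {set V * V} :=
  [set d' | fconnect (face_succ rho) d d'].

Definition faces (rho : V -> V -> V) : {set {set V * V}} :=
  [set face_of rho d | d in darts].

(* plane embedding: a rotation system of genus 0 (Euler's formula
   V - E + F = 2), the combinatorial characterisation of embeddings of a
   connected graph in the sphere (Heffter-Edmonds-Ringel). *)
Definition plane_embedding (rho : V -> V -> V) :=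
  rotation_system rho /\ #|V| + #|faces rho| = nedges + 2.

Definition fullerene :=
  [/\ simple_graph, cubic, three_connected &
      exists rho, plane_embedding rho /\
        forall d, d \in darts -> #|face_of rho d| \in [:: 5; 6]].

Definition is_cycle (p : seq V) := [&& uniq p, 3 <= size p & cycle e p].

End Fullerene.

(* Main.v *)
(* Colour the faces with two colours so that both colour classes are connected
   in the dual; the bichromatic edges then form a cycle, and the vertices it
   misses are those whose three faces have the same colour. Take such a
   colouring with the longest cycle. Recolouring a face whose k like-coloured
   neighbours are consecutive around it, and whose other m neighbours are all
   opposite, keeps both classes connected and changes the length by k - m. Short
   sequences of such moves show that in the optimal colouring a face meets at
   most two missed vertices, that a face meeting two of them has neighbours
   meeting none, and that discharging its excess to these neighbours leaves an
   average of at most one missed vertex per face. A vertex lies on three faces,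
   so at most F/3 = (n + 4)/6 vertices are missed.
   Planarity enters only through Euler's formula: over F_2 it makes every cycle
   a cut of the dual graph and every dual cycle a cut of the graph. *)
Require Import Defs.
From mathcomp Require Import all_boot all_algebra.
From mathcomp Require Import zify.
Set Implicit Arguments. Unset Strict Implicit. Unset Printing Implicit Defensive.

(** Seen from a face, a colouring is a cyclic word of five or six bits. At a cubic vertex two bits
    determine the third, so the words of adjacent faces share three bits, and most claims become a
    check over the 32 + 64 possible words. Optimality enters through sequences of at most three
    recolourings. An intermediate colouring need only be valid, so a loss of four edges may be
    repaid later, and neutral moves lead to other optimal colourings, which obey the same
    constraints. The obstacle is the discharging step: bounding the charge a face receives by its
    own word alone fails for exactly three words up to rotation. These need moves at several faces
    around the receiver, and then the possible adjacencies among the recoloured faces must be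
    controlled. Charges are doubled because some faces split their unit between two edges. *)

Lemma card_sum_bool (T : finType) (P : pred T) : #|[set d | P d]| = \sum_d P d.
Proof. by rewrite -sum1_card big_mkcond; apply: eq_bigr => d _; rewrite inE; case: (P d). Qed.

(** * Exactness over F_2: cycles, cuts and Euler's formula *)

Section Exactness.
Import GRing.Theory.
Local Open Scope ring_scope.
Variables (D : finType) (al : D -> D).
Hypothesis alK : involutive al.
Hypothesis al_neq : forall d, al d != d.

(* One dart of each edge. *)
Definition forward : {set D} := [set d | (enum_rank d < enum_rank (al d))%N].

Lemma forward_al d : (al d \in forward) = (d \notin forward).
Proof.
have ne : enum_rank (al d) != enum_rank d by rewrite (inj_eq enum_rank_inj).
by rewrite !inE alK -leqNgt [in RHS]leq_eqVlt [eq_op _ _](negbTE ne).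
Qed.

Lemma sum_forward (f : D -> nat) :
  (\sum_d f d = \sum_(d in forward) (f d + f (al d)))%N.
Proof.
rewrite [LHS](bigID (mem forward)) big_split /=; congr (_ + _)%N.
rewrite (reindex_inj (inv_inj alK)) /=; apply: eq_bigl => d.
by rewrite forward_al negbK.
Qed.

Lemma card_forward : #|D| = (2 * #|forward|)%N.
Proof.
have E := sum_forward (fun _ => 1%N); rewrite sum_nat_const mulnC in E.
by rewrite -E -sum1_card; apply: eq_bigl.
Qed.

Lemma F2_cases (x : 'F_2) : x = 0 \/ x = 1.
Proof. by case: x => -[|[|]] // ?; [left | right]; apply: val_inj. Qed.

Lemma F2_add_eq0 (x y : 'F_2) : (x + y == 0) = (x == y).
Proof. by have [->|->] := F2_cases x; have [->|->] := F2_cases y. Qed.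

Section Incidence.
Variables (P : finType) (p : D -> P).

(** The two terms cancel on a loop, which therefore gives a zero column. *)
Definition incidence : 'M['F_2]_(#|P|, #|forward|) :=
  \matrix_(i, j) ((p (enum_val j) == enum_val i)%:R +
                  (p (al (enum_val j)) == enum_val i)%:R).

Lemma mul_incidence (u : 'rV_#|P|) j : (u *m incidence) 0 j =
  u 0 (enum_rank (p (enum_val j))) + u 0 (enum_rank (p (al (enum_val j)))).
Proof.
rewrite mxE; under eq_bigr => i _ do rewrite mxE mulrDr.
have pick a : \sum_i u 0 i * (a == enum_val i)%:R = u 0 (enum_rank a).
  rewrite (bigD1 (enum_rank a)) //= enum_rankK eqxx mulr1 big1 ?addr0 // => i ni.
  by case: eqP => [E|]; rewrite ?mulr0 //; case/eqP: ni; rewrite E enum_valK.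
by rewrite big_split /= !pick.
Qed.

Hypothesis connP : forall h : P -> bool,
  (forall d, h (p d) = h (p (al d))) -> forall x y, h x = h y.

(** A row vector killed by the matrix is a function on [P] that agrees at both ends of every edge,
    hence constant by [connP]; so the left kernel is at most a line. *)
Lemma rank_incidence : (#|P| <= \rank incidence + 1)%N.
Proof.
have ker1 : (kermx incidence <= (const_mx 1 : 'rV_#|P|))%MS.
  apply/row_subP => i; set v := row i _.
  have v0 : v *m incidence = 0.
    by apply/sub_kermxP; apply: row_sub.
  have vE x y : v 0 (enum_rank x) = v 0 (enum_rank y).
    have /(_ (fun z => v 0 (enum_rank z) == v 0 (enum_rank y)) _ x y) := connP.
    rewrite eqxx => E; apply/eqP/E => d.
    have dE z : z \in forward -> v 0 (enum_rank (p z)) = v 0 (enum_rank (p (al z))).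
      move=> zf; apply/eqP; rewrite -F2_add_eq0.
      by have := mul_incidence v (enum_rank_in zf z); rewrite enum_rankK_in // v0 mxE => <-.
    have [/dE -> //|] := boolP (d \in forward).
    by rewrite -forward_al => /dE; rewrite alK => ->.
  apply/sub_rVP; have [x _|P0] := pickP (mem P).
    exists (v 0 (enum_rank x)); apply/rowP => j.
    by rewrite [RHS]mxE [X in _ * X]mxE mulr1 -(enum_valK j); apply: vE.
  exists 0; apply/rowP => j; have := P0 (enum_val j); by rewrite inE.
have := mxrankS ker1; rewrite mxrank_ker => le.
have := leq_trans le (rank_leq_row _); have := rank_leq_row incidence; lia.
Qed.

End Incidence.

Variables (P Q : finType) (p : D -> P) (q : D -> Q).
Hypothesis connP : forall h : P -> bool,
  (forall d, h (p d) = h (p (al d))) -> forall x y, h x = h y.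
Hypothesis connQ : forall h : Q -> bool,
  (forall d, h (q d) = h (q (al d))) -> forall x y, h x = h y.
(** Doubled because [#|D|] is twice the number of edges. Being symmetric in [P] and [Q], it serves
    both the graph and its dual. *)
Hypothesis euler : (2 * (#|P| + #|Q|) = #|D| + 4)%N.

Lemma natr_F2 n : (n%:R == 0 :> 'F_2) = ~~ odd n.
Proof.
have two : 2%:R = 0 :> 'F_2 by apply: val_inj.
rewrite -{1}(odd_double_half n) -muln2 natrD natrM two mulr0 addr0.
by case: (odd n).
Qed.

Lemma sum_incidence (f : D -> bool) a : (forall d, f (al d) = f d) ->
  \sum_(j < #|forward|) (f (enum_val j))%:R * incidence p (enum_rank a) j =
    (#|[set d | (p d == a) && f d]|%:R : 'F_2).
Proof.
move=> fal.
rewrite card_sum_bool sum_forward natr_sum [RHS]big_enum_val /=; apply: eq_bigr => j _.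
rewrite !mxE enum_rankK fal natrD.
by case: (p (enum_val j) == a); case: (p (al _) == a); case: (f _); rewrite /= ?mul0r ?mul1r ?mulr0 ?addr0 ?add0r.
Qed.

Hypothesis orthogonal : forall a b,
  ~~ odd (#|[set d | (p d == a) && (q d == b)]| + #|[set d | (p d == a) && (q (al d) == b)]|).

(* Orthogonality of the two incidence matrices and Euler's formula force the
   image of the one to be the whole kernel of the other. *)
Lemma cocycle_is_coboundary (z : D -> bool) : (forall d, z (al d) = z d) ->
  (forall a, ~~ odd #|[set d | (p d == a) && z d]|) ->
  exists h : Q -> bool, forall d, z d = h (q d) (+) h (q (al d)).
Proof.
move=> zal zeven; set A := incidence p; set B := incidence q.
have BA : B *m A^T = 0.
  apply/matrixP => i' i; rewrite -(enum_valK i) -(enum_valK i') !mxE.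
  set a := enum_val i; set b := enum_val i'.
  pose f d := (q d == b) (+) (q (al d) == b).
  under eq_bigr => j _.
    rewrite [A^T _ _]mxE (_ : B _ j = (f (enum_val j))%:R); last first.
      rewrite mxE enum_rankK /f -/b.
      by case: (q (enum_val j) == b); case: (q (al _) == b); apply: val_inj.
    over.
  rewrite sum_incidence => [|d]; last by rewrite /f alK addbC.
  apply/eqP; rewrite natr_F2.
  rewrite (_ : odd _ = odd (#|[set d | (p d == a) && (q d == b)]| +
      #|[set d | (p d == a) && (q (al d) == b)]|)) ?orthogonal //.
  (* Darts with [b] on both sides are counted twice, so modulo two only those with [b] on exactly
     one side remain. *)
  have -> : (#|[set d | (p d == a) && (q d == b)]| +
      #|[set d | (p d == a) && (q (al d) == b)]|)%N =
     (#|[set d | (p d == a) && f d]| +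
      (#|[set d | [&& p d == a, q d == b & q (al d) == b]]|).*2)%N.
    rewrite !card_sum_bool -addnn -!big_split /=; apply: eq_bigr => d _.
    by rewrite /f; case: (p d == a); case: (q d == b); case: (q (al d) == b).
  by rewrite oddD odd_double addbF.
pose zz : 'rV['F_2]_#|forward| := \row_j (z (enum_val j))%:R.
have zA : zz *m A^T = 0.
  apply/rowP => i; rewrite -(enum_valK i) !mxE.
  under eq_bigr => j _ do rewrite [zz _ _]mxE [A^T _ _]mxE.
  by rewrite sum_incidence //; apply/eqP; rewrite natr_F2.
have BsubK : (B <= kermx A^T)%MS by apply/sub_kermxP.
(* Dimension count: the kernel has dimension at most E - (P - 1), which is Q - 1 by Euler's formula,
   and [B] has rank at least Q - 1. *)
have KsubB : (kermx A^T <= B)%MS.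
  rewrite -(geq_leqif (mxrank_leqif_sup BsubK)) mxrank_ker mxrank_tr.
  have rA := rank_incidence connP; have rB := rank_incidence connQ.
  have := rank_leq_row A; have := euler; rewrite card_forward -/A -/B in rA rB *; lia.
have /submxP[H zE] : (zz <= B)%MS by apply: submx_trans KsubB; apply/sub_kermxP.
exists (fun b => H 0 (enum_rank b) != 0) => d.
have main e : e \in forward ->
    z e = (H 0 (enum_rank (q e)) != 0) (+) (H 0 (enum_rank (q (al e))) != 0).
  move=> ef; have := mul_incidence q H (enum_rank_in ef e).
  rewrite enum_rankK_in // -/B -zE mxE enum_rankK_in //.
  have [->|->] := F2_cases (H 0 (enum_rank (q e)));
    have [->|->] := F2_cases (H 0 (enum_rank (q (al e)))); by case: (z e).
have [/main //|] := boolP (d \in forward).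
by rewrite -forward_al => /main; rewrite alK zal addbC.
Qed.

End Exactness.

(** * Cyclic bit words and the discharging rule *)

(** The run is neither empty nor full: after recolouring, a face with a full run would have no
    neighbour of its new colour. *)
Definition single_run (p : seq bool) :=
  has (fun j => has (fun k =>
    rot j p == nseq k true ++ nseq (size p - k) false) (iota 1 (size p).-1))
    (iota 0 (size p)).

(* Necessary for optimality: no recolouring of the face gains length. *)
Definition good (p : seq bool) :=
  single_run p ==> (count id p <= count negb p).

Fixpoint bit_seqs n : seq (seq bool) :=
  if n is n'.+1 then
    [seq true :: s | s <- bit_seqs n'] ++ [seq false :: s | s <- bit_seqs n']
  else [:: [::]].

(** Turns a claim about all words of a face into a computation. *)
Lemma bit_seqs_complete (P : pred (seq bool)) :
  all P (bit_seqs 5) && all P (bit_seqs 6) ->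
  forall p, size p \in [:: 5; 6] -> P p.
Proof.
have mem p : p \in bit_seqs (size p).
  elim: p => //= b p IH; rewrite mem_cat; apply/orP.
  by case: b; [left | right]; apply/mapP; exists p.
case/andP=> /allP P5 /allP P6 p; rewrite !inE => /orP[]/eqP E.
  by apply: P5; rewrite -E.
by apply: P6; rewrite -E.
Qed.

(* Twice the charge sent across the first edge of a face with pattern [p]; only
   the faces meeting two missed vertices send charge, a total of one unit each. *)
Definition weight (p : seq bool) : nat :=
  if p == [:: false; false; true; true; true; false] then 2 else
  p \in [:: [:: false; true; true; false; true; true];
            [:: false; true; true; true; false; true];
            [:: false; true; false; true; true; true]].

(* Upper bound on twice the charge entering through the first edge. *)
Definition received (p : seq bool) : nat :=
  if p \in [:: [:: false; true; false; true; false; true];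
               [:: false; true; false; false; false; true]] then 2 else
  p \in [:: [:: false; false; true; false; false; false];
            [:: false; false; false; true; false; false];
            [:: false; false; false; false; true; false];
            [:: false; false; true; false; true; false]].

Definition rot_sum (F : seq bool -> nat) p :=
  sumn (mkseq (fun i => F (rot i p)) (size p)).

(* Whether the vertex between the first two edges of the face is missed. *)
Definition lost (p : seq bool) : nat := nth false p 0 && nth false p 1.

(** * Two-colourings of the faces of a cubic map *)

Section Core.
(* [D] is the set of darts, [al] reverses a dart, [ph] is the next dart around
   the face [fc d] on the chosen side of [d]. A colouring is a function on darts
   that is constant on faces. *)
Variables (D Q : finType) (al ph : D -> D) (fc : D -> Q).
Hypothesis alK : involutive al.
Hypothesis ph_inj : injective ph.
Hypothesis fcP : forall x y, (fc x == fc y) = fconnect ph x y.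
(* Every vertex has degree three. *)
Hypothesis triE : forall z, ph (al (ph (al (ph z)))) = al z.
Hypothesis deg56 : forall x, order ph x \in [:: 5; 6].
(** Two faces share at most one edge. In a plane graph, this and [no_self] express that no one or
    two edges form a cut. *)
Hypothesis link_inj : forall x y, fc x = fc y -> fc (al x) = fc (al y) -> x = y.
Hypothesis no_self : forall x, fc (al x) != fc x.
Hypothesis map_conn :
  forall x y, connect [rel x y | (fc x == fc y) || (y == al x)] x y.

Implicit Types (c : {ffun D -> bool}) (x y z d : D).

Definition same_side c x y :=
  (c x == c y) && ((fc x == fc y) || (y == al x)).
Arguments same_side c x y /.

(** Constant colourings are valid; only optimality rules them out, in [best_nontrivial]. *)
Definition valid c :=
  [forall x, c (ph x) == c x] &&
  [forall x, forall y, (c x == c y) ==> connect (same_side c) x y].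

(* [pat c x] lists the neighbours of the face of [x], starting across [x]:
   [true] for those of the same colour as the face itself. *)
Definition bit c x := c (al x) == c x.
Definition pat c x := [seq bit c y | y <- orbit ph x].
Definition flip d c := [ffun y => c y (+) (fc y == fc d)].
(* Twice the number of bichromatic edges. *)
Definition len c := \sum_x ~~ bit c x.
Definition best c := valid c && [forall c', valid c' ==> (len c' <= len c)].

Lemma fc_ph x : fc (ph x) = fc x.
Proof. by apply/eqP; rewrite eq_sym fcP fconnect1. Qed.

Lemma fc_iter n x : fc (iter n ph x) = fc x.
Proof. by elim: n => //= n IH; rewrite fc_ph. Qed.

Lemma same_side_sym c : connect_sym (same_side c).
Proof.
apply: sym_connect_sym => x y /=.
by rewrite /= (eq_sym (c y)) (eq_sym (fc y)) (eq_sym x) (can2_eq alK alK).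
Qed.

Lemma validP c : reflect ((forall x y, fc x = fc y -> c x = c y) /\
    (forall x y, c x = c y -> connect (same_side c) x y)) (valid c).
Proof.
apply: (iffP andP) => [[/forallP inv /forallP con]|[inv con]]; split.
- move=> x y /eqP; rewrite fcP => /iter_findex <-.
  by elim: (findex _ _ _) => //= n ->; rewrite (eqP (inv _)).
- by move=> x y cxy; move/forallP: (con x) => /(_ y) /implyP -> //; apply/eqP.
- by apply/forallP => x; apply/eqP/inv; rewrite fc_ph.
- by apply/forallP => x; apply/forallP => y; apply/implyP => /eqP /con.
Qed.

Lemma bit_al c x : bit c (al x) = bit c x.
Proof. by rewrite /bit alK eq_sym. Qed.

Lemma bit_flip d c y :
  bit (flip d c) y = bit c y (+) (fc (al y) == fc d) (+) (fc y == fc d).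
Proof. by rewrite /bit !ffunE; do 2!case: (c _); do 2!case: (_ == fc d). Qed.

Lemma flip_face d d' c : fc d = fc d' -> flip d c = flip d' c.
Proof. by move=> E; apply/ffunP => x; rewrite !ffunE E. Qed.

Lemma mem_face x y : (y \in orbit ph x) = (fc y == fc x).
Proof. by rewrite -fconnect_orbit eq_sym fcP. Qed.

Lemma face_sum d (g : D -> nat) :
  \sum_(y | fc y == fc d) g y = \sum_(y <- orbit ph d) g y.
Proof.
rewrite big_uniq ?orbit_uniq //=.
by apply: eq_bigl => y; rewrite mem_face.
Qed.

Lemma order_face x y : fc x = fc y -> order ph x = order ph y.
Proof. by move=> E; apply: eq_card => z; rewrite !inE -!fcP E. Qed.

Lemma orbit_ph x : orbit ph (ph x) = rot 1 (orbit ph x).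
Proof.
rewrite /orbit (order_face (fc_ph x)) -orderSpred [in RHS]/= rot1_cons trajectSr.
by rewrite -iterSr orderSpred iter_order.
Qed.

Lemma orbit_iter x j : j <= order ph x -> orbit ph (iter j ph x) = rot j (orbit ph x).
Proof.
elim: j => [|j IH] lt; first by rewrite rot0.
by rewrite /= orbit_ph IH -?rotS ?size_orbit // ltnW.
Qed.

Lemma pat_iter c x j : j <= order ph x -> pat c (iter j ph x) = rot j (pat c x).
Proof. by move=> lt; rewrite /pat orbit_iter // map_rot. Qed.

Lemma size_pat c x : size (pat c x) = order ph x.
Proof. by rewrite size_map size_orbit. Qed.

Lemma nth_pat c x i : i < order ph x -> nth false (pat c x) i = bit c (iter i ph x).
Proof. by move=> lt; rewrite (nth_map x) ?size_orbit // nth_traject. Qed.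

(* Two consecutive neighbours of a face are adjacent to each other. *)
Lemma link_step c z : (forall x y, fc x = fc y -> c x = c y) ->
  c (al z) = c (al (ph z)) -> connect (same_side c) (al z) (al (ph z)).
Proof.
move=> inv E; set q := al (ph (al (ph z))).
have fq : fc q = fc (al z) by rewrite -(triE z) fc_ph.
have fr : fc (al q) = fc (al (ph z)) by rewrite alK fc_ph.
apply: (@connect_trans _ _ q); first by apply: connect1; rewrite /= fq (inv _ _ fq) !eqxx.
apply: (@connect_trans _ _ (al q)); apply: connect1 => /=.
  by rewrite (inv _ _ fr) (inv _ _ fq) E !eqxx orbT.
by rewrite (inv _ _ fr) fr !eqxx.
Qed.

(** * Recolouring one face *)

Lemma flip_inv c d : (forall x y, fc x = fc y -> c x = c y) ->
  forall x y, fc x = fc y -> flip d c x = flip d c y.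
Proof. by move=> inv x y E; rewrite !ffunE E (inv _ _ E). Qed.

(** The old class stays connected without the face: a path entering the face does so through one of
    its first [k] neighbours, and [link_step] chains these together around it. *)
Lemma flip_connected c d k : valid c -> k <= order ph d ->
  (forall i, i < order ph d -> bit c (iter i ph d) = (i < k)) ->
  forall x y, c x = c d -> c y = c d -> fc x != fc d -> fc y != fc d ->
  connect (same_side (flip d c)) x y.
Proof.
move=> /validP[inv con] kd bits.
have inv' := flip_inv d inv.
have out i : flip d c (al (iter i ph d)) = c (al (iter i ph d)).
  by rewrite ffunE -(fc_iter i d) (negbTE (no_self _)) addbF.
have toseg i : i < k -> connect (same_side (flip d c)) (al (iter i ph d)) (al d).
  elim: i => [|i IH] lt; first exact: connect0.
  apply: connect_trans (IH (ltnW lt)).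
  rewrite same_side_sym; apply: link_step => //.
  have b1 := bits i.+1 (leq_trans lt kd); have b0 := bits i (leq_trans (ltnW lt) kd).
  rewrite (out i) (out i.+1) /=.
  move: b0 b1; rewrite lt (ltnW lt) /bit (inv (iter i.+1 ph d) d) ?fc_iter //.
  by rewrite (inv (iter i ph d) d) ?fc_iter // => /eqP -> /eqP ->.
(* Follow the path up to its first entry into the face, then go round to [al d]. *)
have key p x : path (same_side c) x p -> fc x != fc d -> fc (last x p) = fc d ->
    c x = c d -> connect (same_side (flip d c)) x (al d).
  elim: p x => [|y p IH] x /=; first by move=> _ /eqP.
  case/andP=> /andP[/eqP cxy sxy] pth nx lst cx.
  have [fy|nfy] := eqVneq (fc y) (fc d).
    case/orP: sxy => [/eqP E|/eqP yx]; first by rewrite E fy eqxx in nx.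
    have : fconnect ph d y by rewrite -fcP fy.
    move=> dy; have it := iter_findex dy; have lt := findex_max dy.
    have -> : x = al (iter (findex ph d y) ph d) by rewrite it yx alK.
    by apply: toseg; rewrite -bits // it /bit yx alK -yx cxy.
  apply: (@connect_trans _ _ y); last by apply: IH => //; rewrite -cxy.
  apply: connect1; rewrite /= sxy !ffunE (negbTE nx) (negbTE nfy) !addbF.
  by rewrite cxy eqxx.
have all_ x : c x = c d -> fc x != fc d -> connect (same_side (flip d c)) x (al d).
  by move=> cx nx; have /connectP[p pth E] := con _ _ cx; apply: (key p); rewrite // -E.
move=> x y cx cy nx ny; apply: connect_trans (all_ x cx nx) _.
by rewrite same_side_sym all_.
Qed.

(** The neighbour in position [k] attaches the face to its new class. If [k] is the full degree
    there is no such neighbour, and the new class must have been empty, as when a constant colouring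
    receives its first face of the other colour. *)
Lemma flip_valid c d k : valid c -> k <= order ph d ->
  (forall i, i < order ph d -> bit c (iter i ph d) = (i < k)) ->
  (k = order ph d -> forall z, c z = c d) -> valid (flip d c).
Proof.
move=> vc kd bits other; have /validP[inv con] := vc.
have inv' := flip_inv d inv.
have keep x y : c x != c d -> c y != c d -> connect (same_side (flip d c)) x y.
  move=> cx cy; have cxy : c x = c y by move: cx cy; do 3!case: (c _).
  have /connectP[p pth ->] := con _ _ cxy.
  elim: p x cx cxy pth => [|z p IH] x cx cxy /=; first by rewrite connect0.
  case/andP=> /andP[/eqP cxz sxz] pth.
  apply: (@connect_trans _ _ z); last by apply: IH; rewrite // -cxz.
  apply: connect1; rewrite /= sxz !ffunE andbT.
  have nf w : c w != c d -> fc w == fc d = false.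
    by apply: contraNF => /eqP /inv ->.
  by rewrite !nf -?cxz // cxz.
have todf x : c x != c d -> connect (same_side (flip d c)) x d.
  move=> cx; have [E|lt] := eqVneq k (order ph d).
    by rewrite (other E x) eqxx in cx.
  have {}lt : k < order ph d by rewrite ltn_neqAle lt.
  have bk : c (al (iter k ph d)) != c d.
    by have := bits k lt; rewrite ltnn /bit (inv _ d (fc_iter k d)) => ->.
  apply: connect_trans (keep _ _ cx bk) _.
  apply: (@connect_trans _ _ (iter k ph d)); apply: connect1 => /=.
    rewrite alK eqxx orbT andbT (inv' (iter k ph d) d (fc_iter k d)) !ffunE eqxx.
    rewrite -(fc_iter k d) (negbTE (no_self _)).
    by move: bk; do 2!case: (c _).
  by rewrite (inv' _ _ (fc_iter k d)) fc_iter !eqxx.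
apply/validP; split=> // x y.
have [fx|nx] := eqVneq (fc x) (fc d); have [fy|ny] := eqVneq (fc y) (fc d).
- by move=> _; apply: connect1; rewrite /= (inv' x y) fx ?fy ?eqxx.
- rewrite (inv' _ _ fx) !ffunE eqxx (negbTE ny) addbF addbT => E.
  rewrite same_side_sym; apply: (@connect_trans _ _ d).
    by apply: todf; rewrite -E; case: (c d).
  by apply: connect1; rewrite /= (inv' x d) // fx !eqxx.
- rewrite (inv' _ _ fy) !ffunE eqxx (negbTE nx) addbF addbT => E.
  apply: (@connect_trans _ _ d); first by apply: todf; rewrite E; case: (c d).
  by apply: connect1; rewrite /= (inv' y d) // fy !eqxx.
- rewrite !ffunE (negbTE nx) (negbTE ny) !addbF => E.
  have [cx|cx] := eqVneq (c x) (c d).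
    by apply: (flip_connected vc kd bits); rewrite // -E.
  by apply: keep; rewrite // -E.
Qed.

Lemma count_pat a c d : count a (pat c d) = \sum_(y | fc y == fc d) a (bit c y).
Proof.
by rewrite face_sum /pat count_map -sum1_count big_mkcond; apply: eq_bigr => y _ /=; case: (a _).
Qed.

(** Recolouring swaps like and unlike edges around the face and affects no other edge. The doubling
    arises because [len] counts both darts of an edge. *)
Lemma len_flip d c :
  len (flip d c) + (count negb (pat c d)).*2 = len c + (count id (pat c d)).*2.
Proof.
have split_sum (g : D -> bool) : (forall x, g (al x) = g x) ->
    \sum_x (g x : nat) = (\sum_(x | fc x == fc d) g x).*2
       + \sum_(x | (fc x != fc d) && (fc (al x) != fc d)) g x.
  move=> gal; rewrite (bigID [pred x | fc x == fc d]) /= -addnn -addnA; congr addn.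
  rewrite (bigID [pred x | fc (al x) == fc d]) /=; congr addn.
  rewrite (reindex_inj (inv_inj alK)) /=; apply: eq_big => [x|x _]; last by rewrite gal.
  by rewrite alK; have [<-|_] := eqVneq (fc x) (fc d); rewrite ?andbF // no_self.
have galb c' x : ~~ bit c' (al x) = ~~ bit c' x by rewrite bit_al.
rewrite /len !(split_sum _ (galb _)) !count_pat.
have -> : \sum_(x | fc x == fc d) ~~ bit (flip d c) x = \sum_(x | fc x == fc d) bit c x.
  apply: eq_bigr => x /eqP E; rewrite bit_flip E eqxx -E (negbTE (no_self x)).
  by case: bit.
have -> : \sum_(x | (fc x != fc d) && (fc (al x) != fc d)) ~~ bit (flip d c) x =
          \sum_(x | (fc x != fc d) && (fc (al x) != fc d)) ~~ bit c x.
  by apply: eq_bigr => x /andP[n1 n2]; rewrite bit_flip (negbTE n1) (negbTE n2) !addbF.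
lia.
Qed.

Lemma flip_run c d : valid c -> single_run (pat c d) -> valid (flip d c).
Proof.
move=> vc /hasP[j]; rewrite size_pat mem_iota add0n => /andP[_ ltj].
case/hasP=> k; rewrite mem_iota => /andP[k0 ltk] /eqP E.
have {}ltk : k < order ph d by rewrite add1n prednK // in ltk; apply: order_gt0.
rewrite -pat_iter ?(ltnW ltj) // in E.
have fj := fc_iter j d; rewrite -(flip_face c fj).
have oj := order_face fj.
apply: (@flip_valid _ _ k) => //; rewrite oj; first exact: ltnW.
  move=> i lti; rewrite -nth_pat ?oj // E nth_cat size_nseq !nth_nseq.
  by case: ltnP => //; rewrite ?if_same.
by move=> ek; rewrite ek ltnn in ltk.
Qed.

Lemma best_valid c : best c -> valid c.
Proof. by case/andP. Qed.

Lemma best_len c c' : best c -> valid c' -> len c' <= len c.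
Proof. by case/andP=> _ /forallP/(_ c')/implyP. Qed.

Lemma best_good c d : best c -> good (pat c d).
Proof.
move=> bc; apply/implyP => run.
have := best_len bc (flip_run (best_valid bc) run).
have := len_flip d c; lia.
Qed.

(** A neutral move yields another optimal colouring, so [best_good] applies again afterwards. *)
Lemma best_flip c d : best c -> single_run (pat c d) ->
  count id (pat c d) = count negb (pat c d) -> best (flip d c).
Proof.
move=> bc run E; rewrite /best flip_run ?best_valid //=.
apply/forallP=> c'; apply/implyP => /(best_len bc).
by have := len_flip d c; rewrite E => /addIn ->.
Qed.

Lemma pat_flip_far c d x : fc x != fc d ->
  (forall y, fc y = fc x -> fc (al y) != fc d) -> pat (flip d c) x = pat c x.
Proof.
move=> nx ny; apply/eq_in_map => y; rewrite mem_face => /eqP yx.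
by rewrite bit_flip yx (negbTE nx) (negbTE (ny y yx)) !addbF.
Qed.

Lemma pat_cons c x : pat c x = bit c x :: [seq bit c y | y <- behead (orbit ph x)].
Proof. by rewrite /pat /orbit -orderSpred. Qed.

(** Only the first bit changes because, by [link_inj], the two faces meet along [x] alone. *)
Lemma pat_flip_near c d x : fc (al x) = fc d ->
  pat (flip d c) x = ~~ bit c x :: behead (pat c x).
Proof.
move=> E; have nx : fc x != fc d by rewrite -E eq_sym no_self.
rewrite !pat_cons bit_flip E (negbTE nx) eqxx addbF addbT /=; congr cons.
apply/eq_in_map => y yo.
have U := orbit_uniq ph x.
have orbE : orbit ph x = x :: behead (orbit ph x) by rewrite /orbit -orderSpred.
have yx : fc y = fc x by apply/eqP; rewrite -mem_face orbE inE yo orbT.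
have nyx : y != x by apply: contraTneq yo => ->; move: U; rewrite orbE /= => /andP[].
rewrite bit_flip yx (negbTE nx) addbF.
case: eqP => [F|_]; last by rewrite addbF.
by case/eqP: nyx; apply: link_inj; rewrite // F.
Qed.

(** * Overlap of the words of adjacent faces *)

Lemma size_pat56 c x : size (pat c x) \in [:: 5; 6].
Proof. by rewrite size_pat. Qed.

Lemma iter_inj x i j : i < order ph x -> j < order ph x ->
  iter i ph x = iter j ph x -> i = j.
Proof.
move=> li lj E; apply/eqP; rewrite -(nth_uniq x _ _ (orbit_uniq ph x)) ?size_orbit //.
by rewrite /orbit !nth_traject // E.
Qed.

Lemma link_iter x i j : i < order ph x -> j < order ph x ->
  fc (al (iter i ph x)) = fc (al (iter j ph x)) -> i = j.
Proof. by move=> li lj E; apply: (@iter_inj x) => //; apply: link_inj; rewrite ?fc_iter. Qed.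

Lemma iter_face x y : fc y = fc x -> exists2 i, i < order ph x & y = iter i ph x.
Proof.
move=> /eqP; rewrite eq_sym fcP => xy.
by exists (findex ph x y); rewrite ?findex_max ?iter_findex.
Qed.

Lemma prevE z : al (ph (al (ph z))) = finv ph (al z).
Proof. by apply: ph_inj; rewrite f_finv // triE. Qed.

Lemma nbr_next z : fc (al (ph (al (ph z)))) = fc (al z).
Proof. by rewrite prevE -[LHS]fc_ph f_finv. Qed.

Lemma nbr_prev z : fc (al (finv ph (al z))) = fc (al (ph z)).
Proof. by rewrite -prevE alK fc_ph. Qed.

(* The faces across [z] and [ph z] are adjacent; both sides denote the face at
   the far end of their common edge. *)
Lemma nbr_second z :
  fc (al (ph (ph (al (ph z))))) = fc (al (finv ph (finv ph (al z)))).
Proof. by rewrite -[ph (al (ph z))]alK prevE -(nbr_next (finv _ _)) f_finv. Qed.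

(** Among the three faces at a vertex the number of unlike pairs is zero or two. *)
Lemma bit_next c z : valid c -> bit c (ph (al (ph z))) = (bit c z == bit c (ph z)).
Proof.
move=> /validP[inv _]; rewrite /bit (inv _ _ (nbr_next z)) (inv _ _ (fc_ph _)).
by rewrite (inv _ _ (fc_ph z)); do 3!case: (c _).
Qed.

Lemma bit_prev c z : valid c -> bit c (finv ph (al z)) = (bit c z == bit c (ph z)).
Proof. by move=> vc; rewrite -prevE bit_al bit_next. Qed.

Lemma iterp x : iter (order ph x).-1 ph x = finv ph x.
Proof. by []. Qed.

Lemma link_bits c x : valid c ->
  [/\ nth false (pat c (al x)) 0 = nth false (pat c x) 0,
      nth false (pat c (al x)) 1 = (nth false (pat c x) 0 == last false (pat c x)) &
      last false (pat c (al x)) = (nth false (pat c x) 0 == nth false (pat c x) 1)].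
Proof.
move=> vc.
have n0 y : nth false (pat c y) 0 = bit c y by rewrite pat_cons.
have n1 y : nth false (pat c y) 1 = bit c (ph y).
  by rewrite nth_pat //; have := deg56 y; rewrite !inE => /orP[]/eqP->.
have nl y : last false (pat c y) = bit c (finv ph y).
  rewrite -nth_last nth_pat ?size_pat ?iterp //.
  by rewrite prednK ?order_gt0.
rewrite !n0 !n1 !nl bit_al bit_prev //; split=> //.
by rewrite -{1}(f_finv ph_inj x) bit_next ?f_finv // eq_sym.
Qed.

Lemma isolated c x : valid c -> ~~ has id (pat c x) ->
  forall z, c z = c x -> fc z = fc x.
Proof.
move=> vc /hasPn nb z /esym cz; have /validP[_ con] := vc.
have /connectP[p pth ->] := con _ _ cz.
suff key x' : fc x' = fc x -> path (same_side c) x' p -> fc (last x' p) = fc x by exact: key.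
elim: p x' {pth} => [|y p IH] x' fx //= /andP[/andP[/eqP cxy sxy] pth].
apply: IH => //; case/orP: sxy => [/eqP <- //|/eqP yx].
have := nb (bit c x'); rewrite /bit -yx cxy eqxx => /(_ _)/negP[] //.
by apply/mapP; exists x'; rewrite ?mem_face ?fx // /bit -yx cxy eqxx.
Qed.

(* Recolouring the face across [x] is neutral, so the result is optimal too. *)
Lemma weight2_pat c x : best c -> weight (pat c (al x)) = 2 ->
  pat c x \in [:: [:: false; true; false; true; false; true];
                  [:: false; true; false; false; false; true]].
Proof.
move=> bc; rewrite /weight; case: eqP => [E _|_]; last by case: (_ \in _).
have [] := link_bits (al x) (best_valid bc); rewrite alK E /= => n0 n1 nl.
have bc1 : best (flip (al x) c) by apply: best_flip => //; rewrite E.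
have := best_good x bc1; rewrite (@pat_flip_near c) //.
have -> : bit c x = false by rewrite -n0 pat_cons.
(* The word must be good both before and after the neutral move, which turns its first bit to
   [true]. *)
pose P p := good p ==> (nth false p 0 == false) ==> (nth false p 1 == true) ==>
  (last false p == true) ==> good (true :: behead p) ==>
  (p \in [:: [:: false; true; false; true; false; true];
                  [:: false; true; false; false; false; true]]).
have /(_ _ (size_pat56 c x)) : forall p, size p \in [:: 5; 6] -> P p.
  by apply: bit_seqs_complete; vm_compute.
by rewrite /P n0 n1 nl (best_good x bc) => /= /implyP H /H.
Qed.

(* Recolouring first the face of [x], then the one across [x], exchanges the two
   colours; the first move gives a single run to the second face. *)
Lemma weight1_pat c x : best c -> weight (pat c (al x)) = 1 ->
  pat c x \in [:: [:: false; false; true; false; false; false];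
                  [:: false; false; false; true; false; false];
                  [:: false; false; false; false; true; false];
                  [:: false; false; true; false; true; false]].
Proof.
move=> bc w1; have vc := best_valid bc.
set q := pat c (al x) in w1 *.
have T2 : q \in [:: [:: false; true; true; false; true; true];
            [:: false; true; true; true; false; true];
            [:: false; true; false; true; true; true]].
  by move: w1; rewrite /weight; case: eqP => // _; case: (_ \in _).
have oq : order ph (al x) = 6 by move: T2; rewrite -(size_pat c) -/q !inE => /or3P[]/eqP->.
have [] := link_bits (al x) vc; rewrite alK -/q => n0 n1 nl.
have {}n0 : nth false (pat c x) 0 = false by rewrite n0; move: T2; rewrite !inE => /or3P[]/eqP->.
have {}n1 : nth false (pat c x) 1 = false by rewrite n1; move: T2; rewrite !inE => /or3P[]/eqP->.
have {}nl : last false (pat c x) = false by rewrite nl; move: T2; rewrite !inE => /or3P[]/eqP->.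
have b0 : bit c x = false by rewrite -n0 pat_cons.
(* Otherwise the face of [x] is its whole colour class, yet the face across [x] has a second
   neighbour of that colour. *)
have nz : has id (pat c x).
  apply/negPn/negP => iso.
  have [i [i0 i6 bi]] : exists i, [/\ 0 < i, i < 6 & nth false q i = false].
    by move: T2; rewrite !inE => /or3P[]/eqP->; [exists 3|exists 4|exists 2].
  have /validP[inv _] := vc.
  rewrite nth_pat ?oq // in bi.
  have : fc (al (iter i ph (al x))) = fc x.
    apply: (isolated vc iso); move: bi b0; rewrite /bit.
    by rewrite (inv (iter i ph (al x)) (al x)) ?fc_iter //; do 3!case: (c _).
  rewrite -{2}(alK x) => /(@link_iter (al x) i 0); rewrite oq i6 => E.
  by rewrite (E isT isT) in i0.
(* The second move gains 5 - 1 edges, so the first must lose at least four. *)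
have run1 : single_run (pat c x) -> (count id (pat c x)).*2 + 4 <= size (pat c x).
  move=> run; have v1 := flip_run vc run.
  have P1 : pat (flip x c) (al x) = true :: behead q.
    rewrite (@pat_flip_near c) ?alK // bit_al b0 //.
  have run2 : single_run (pat (flip x c) (al x)).
    by rewrite P1; move: T2; rewrite !inE => /or3P[]/eqP->.
  have := best_len bc (flip_run v1 run2).
  have := len_flip x c; have := len_flip (al x) (flip x c).
  have -> : count negb (pat (flip x c) (al x)) = 1.
    by rewrite P1; move: T2; rewrite !inE => /or3P[]/eqP->.
  have -> : count id (pat (flip x c) (al x)) = 5.
    by rewrite P1; move: T2; rewrite !inE => /or3P[]/eqP->.
  have : count id (pat c x) + count negb (pat c x) = size (pat c x) by exact: count_predC.
  clear; lia.
pose P p := (nth false p 0 == false) ==> (nth false p 1 == false) ==>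
  (last false p == false) ==> has id p ==>
  (single_run p ==> ((count id p).*2 + 4 <= size p)) ==>
  (p \in [:: [:: false; false; true; false; false; false];
                  [:: false; false; false; true; false; false];
                  [:: false; false; false; false; true; false];
                  [:: false; false; true; false; true; false]]).
have /(_ _ (size_pat56 c x)) : forall p, size p \in [:: 5; 6] -> P p.
  by apply: bit_seqs_complete; vm_compute.
by rewrite /P n0 n1 nl nz (introT implyP run1).
Qed.

(** * In an optimal colouring every face has an unlike neighbour *)

Lemma constant_valid : valid [ffun _ => false].
Proof.
apply/validP; split=> [x y _|x y _]; first by rewrite !ffunE.
have := map_conn x y; apply: connect_sub => u v E; apply: connect1.
by rewrite /= !ffunE eqxx.
Qed.

(** Recolouring a single face of a constant colouring already gives positive length. *)
Lemma best_nontrivial c : D -> best c -> exists z, bit c z = false.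
Proof.
move=> x bc.
have mono y : bit [ffun _ => false] y by rewrite /bit !ffunE.
have v1 : valid (flip x [ffun _ => false]).
  apply: (flip_valid constant_valid (leqnn (order ph x))) => [i ->|_ z]; first exact: mono.
  by rewrite !ffunE.
have := best_len bc v1; have := len_flip x [ffun _ => false].
have -> : pat [ffun _ => false] x = nseq (order ph x) true.
  rewrite -(size_pat [ffun _ => false] x); apply/all_pred1P/allP => b /mapP[y _ ->].
  by rewrite mono.
rewrite !count_nseq /= mul0n mul1n => E le.
have [z nz|all1] := pickP (fun z => ~~ bit c z); first by exists z; rewrite (negbTE nz).
have : len c = 0 by rewrite /len big1 // => z _; rewrite all1.
have := order_gt0 ph x; move: E le; clear; lia.
Qed.

Lemma pat_prev c x : pat c x = rot 1 (pat c (finv ph x)).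
Proof. by rewrite -pat_iter ?order_gt0 //= f_finv. Qed.

Lemma bit_nth c x i : i < order ph x -> bit c (iter i ph x) = nth false (pat c x) i.
Proof. by move=> lt; rewrite nth_pat. Qed.

Lemma pat_ph c x : pat c (ph x) = rot 1 (pat c x).
Proof. by rewrite (@pat_iter c x 1) ?order_gt0. Qed.

(* A face with only like-coloured neighbours would have one, [al d], that has
   not. This neighbour and the next one around [d] force their other common
   neighbour [g] to be a leaf of the opposite colour; recolouring [g], the face
   of [al d] and then that of [d] would gain length. *)
Lemma best_not_mono c x : best c -> has negb (pat c x).
Proof.
move=> bc; have vc := best_valid bc; have /validP[inv _] := vc.
apply/negPn/negP => mono.
have [d [md nmd]] : exists d, ~~ has negb (pat c d) /\ has negb (pat c (al d)).
  have [z nz] := best_nontrivial x bc.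
  have nmz : has negb (pat c z) by rewrite pat_cons /= nz.
  have /connectP[p pth zE] := map_conn x z; rewrite {}zE in nmz.
  elim: p x mono pth nmz => [|y p IH] x' m /=; first by rewrite (negbTE m).
  case/andP=> sxy pth nmz.
  have [my|nmy] := boolP (has negb (pat c y)); last exact: (IH y nmy).
  case/orP: sxy => [/eqP E|/eqP yE]; last by exists x'; rewrite -yE m my.
  have [i lti yE] := iter_face (esym E).
  by rewrite yE pat_iter ?(ltnW lti) // has_rot (negbTE m) in my.
have onesE e : fc e = fc d -> pat c e = nseq (order ph e) true.
  move=> fe; have [i lti ->] := iter_face fe.
  rewrite -(size_pat c); apply/all_pred1P/allP => b.
  by rewrite pat_iter ?(ltnW lti) // mem_rot => bp; have /hasPn/(_ b bp) := md; case: b {bp}.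
have nbhd e : fc e = fc d -> has negb (pat c (al e)) ->
    pat c (al e) = [:: true; true; false; true; false; true].
  move=> fe nme.
  have ones := onesE e fe.
  have be : bit c e.
    have := order_gt0 ph e; case: (order ph e) ones => // n.
    by rewrite pat_cons => -[].
  have [] := link_bits e vc.
  have := deg56 e; rewrite ones !inE => oe.
  have -> : nth false (nseq (order ph e) true) 0 = true by case/orP: oe => /eqP->.
  have -> : nth false (nseq (order ph e) true) 1 = true by case/orP: oe => /eqP->.
  have -> : last false (nseq (order ph e) true) = true by case/orP: oe => /eqP->.
  move=> n0 n1 nl.
  pose P p := nth false p 0 ==> nth false p 1 ==> last false p ==> has negb p ==>
    good p ==> (p \in [:: [:: true; true; false; true; false; true];
                          [:: true; true; false; false; false; true]]).
  have /(_ _ (size_pat56 c (al e))) : forall p, size p \in [:: 5; 6] -> P p.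
    by apply: bit_seqs_complete; vm_compute.
  (* The second word is neutral to recolour; the face of [e] would then have a run of all edges but
     one and gain. *)
  rewrite /P n0 n1 nl nme (best_good (al e) bc) !inE /= => /orP[/eqP //|/eqP E].
  have b1 : best (flip (al e) c) by apply: best_flip => //; rewrite E.
  have := best_good e b1; rewrite (@pat_flip_near c) // be ones.
  by case/orP: oe => /eqP->.
have patu := nbhd d erefl nmd.
have ou : order ph (al d) = 6 by rewrite -(size_pat c) patu.
(* The edge of [h] separates the faces of [al d] and [al (finv ph d)], two consecutive neighbours of
   [d]; its end away from [d] lies on the face of [g]. *)
set h := ph (al d); set g := al (ph h); set k := al (ph g).
have fd' : fc (finv ph d) = fc d by rewrite -{2}(f_finv ph_inj d) fc_ph.
have hE : ph (al h) = al (finv ph d).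
  by rewrite /h -{1}(f_finv ph_inj d) triE.
have kE : ph k = al h by rewrite /k /g triE.
have bh : bit c h = true by rewrite /h (@bit_nth c (al d) 1) ?ou ?patu.
have bph : bit c (ph h) = false by rewrite /h (@bit_nth c (al d) 2) ?ou ?patu.
have bk : bit c k = false by rewrite /k bit_al /g bit_next // bh bph.
have fk : fc k = fc (al (finv ph d)) by rewrite -hE -kE !fc_ph.
have pata : pat c (al (finv ph d)) = [:: true; true; false; true; false; true].
  apply: nbhd => //; apply/hasP; exists false => //.
  by rewrite -bk; apply/mapP; exists k => //; rewrite mem_face fk.
have oa : order ph (al (finv ph d)) = 6 by rewrite -(size_pat c) pata.
have patk : pat c k = [:: false; true; true; true; false; true].
  have : rot 2 (pat c k) = rot 2 [:: false; true; true; true; false; true].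
    by rewrite -pat_iter ?(order_face fk) ?oa //= kE hE pata.
  exact: rot_inj.
have patt : pat c (ph h) = [:: false; true; false; true; true; true].
  by rewrite /h !pat_ph patu.
have wg : weight (pat c (al g)) = 1 by rewrite alK patt.
have [_ g1 _] := link_bits (ph h) vc; rewrite -/g patt /= in g1.
have [_ g2 _] := link_bits k vc; rewrite /k alK pat_ph -/k patk /= in g2.
have patg : (pat c g \in [:: [:: false; false; false; true; false; false];
                             [:: false; false; false; false; true; false]]).
  by have := weight1_pat bc wg; move: g2; rewrite !inE => + /or4P[]/eqP E; rewrite E.
have rung : single_run (pat c g) by move: patg; rewrite !inE => /orP[]/eqP->.
have cg : count id (pat c g) = 1 by move: patg; rewrite !inE => /orP[]/eqP->.
have cg' : count negb (pat c g) = 5 by move: patg; rewrite !inE => /orP[]/eqP->.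
have v1 := flip_run vc rung; have l1 := len_flip g c.
have pt1 : pat (flip g c) (ph h) = [:: true; true; false; true; true; true].
  by rewrite pat_flip_near // patt bph.
have v2 : valid (flip (ph h) (flip g c)) by apply: flip_run; rewrite // pt1.
have l2 := len_flip (ph h) (flip g c).
have od := deg56 d.
have ones := onesE d erefl.
have onesb y : fc y = fc d -> bit c y.
  move=> /iter_face[i lti ->]; rewrite bit_nth // ones nth_nseq lti //.
have bd := onesb d erefl.
have cgd : c g != c d.
  move: bd bph; rewrite /bit -/g (inv (ph h) (al d)) /h ?fc_ph // => /eqP ->.
  by case: (c g); case: (c d).
have pd1 : pat (flip g c) d = pat c d.
  apply: pat_flip_far; first by apply: contra cgd => /eqP/inv ->.
  move=> y fy; apply: contra cgd => /eqP/inv <-; have := onesb y fy.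
  by rewrite /bit (inv y d).
have pd2 : pat (flip (ph h) (flip g c)) d = false :: nseq (order ph d).-1 true.
  rewrite pat_flip_near ?pd1; last by rewrite /h !fc_ph.
  have : nth false (pat (flip g c) d) 0 = true by rewrite pd1 -bit_nth ?order_gt0.
  rewrite pat_cons /= => ->; rewrite ones.
  by case: (order ph d) (order_gt0 ph d).
have v3 : valid (flip d (flip (ph h) (flip g c))).
  apply: flip_run => //; rewrite pd2.
  by move: od; rewrite !inE => /orP[]/eqP->.
have l3 := len_flip d (flip (ph h) (flip g c)).
(* The three moves change the number of bichromatic edges by -4, +4 and at least +3. *)
have := best_len bc v3; move: l1 l2 l3; rewrite cg cg' pt1 pd2 /= !count_nseq /=.
by move: od; rewrite !inE => /orP[]/eqP-> /=; clear; lia.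
Qed.

(** * Faces sending charge to a common neighbour *)

Lemma weight2E c x : weight (pat c x) = 2 ->
  pat c x = [:: false; false; true; true; true; false].
Proof. by rewrite /weight; case: eqP => // _; case: (_ \in _). Qed.

Lemma weight1E c x : weight (pat c x) = 1 ->
  pat c x \in [:: [:: false; true; true; false; true; true];
                  [:: false; true; true; true; false; true];
                  [:: false; true; false; true; true; true]].
Proof. by rewrite /weight; case: eqP => // _; case: (_ \in _). Qed.

Lemma finv6 y : order ph y = 6 -> finv ph y = iter 5 ph y.
Proof. by rewrite /finv => ->. Qed.

Lemma finv2_6 y : order ph y = 6 -> finv ph (finv ph y) = iter 4 ph y.
Proof. by move=> o; rewrite (finv6 o) /= finv_f. Qed.

(** These positions stay distinct since faces have at least five edges; the adjacency arguments
    below use this to reach a contradiction. *)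
Lemma far_nbrs s :
  [/\ fc (al (ph (ph s))) <> fc (al (finv ph s)),
      fc (al (ph (ph s))) <> fc (al (finv ph (finv ph s))) &
      fc (al (ph s)) <> fc (al (finv ph (finv ph s)))].
Proof.
have f1 : finv ph s = iter (order ph s).-1 ph s by [].
have f2 : finv ph (finv ph s) = iter (order ph s).-2 ph s.
  apply: ph_inj; rewrite f_finv // f1 -iterS prednK //.
  by have := deg56 s; rewrite !inE => /orP[]/eqP->.
rewrite f2 f1; have := deg56 s; rewrite !inE => /orP[]/eqP o.
  by rewrite o; split; [move/(@link_iter s 2 4)|move/(@link_iter s 2 3)|move/(@link_iter s 1 3)];
    rewrite o => /(_ isT isT).
by rewrite o; split; [move/(@link_iter s 2 5)|move/(@link_iter s 2 4)|move/(@link_iter s 1 4)];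
  rewrite o => /(_ isT isT).
Qed.

Lemma bits_across c y : valid c ->
  (bit c (ph (al y)) = (bit c y == bit c (finv ph y))) *
  (bit c (finv ph (al y)) = (bit c y == bit c (ph y))).
Proof.
move=> vc; split; last exact: bit_prev.
by rewrite -{1}(f_finv ph_inj y) bit_next // f_finv // eq_sym.
Qed.

Lemma bit_iter_next c x i : i < order ph x ->
  bit c (ph (iter i ph x)) = nth false (rot 1 (pat c x)) i.
Proof. by move=> lt; rewrite -iterS iterSr bit_nth ?pat_ph // (order_face (fc_ph x)). Qed.

Lemma bit_iter_prev c x i : i < order ph x ->
  bit c (finv ph (iter i ph x)) = nth false (rotr 1 (pat c x)) i.
Proof.
move=> lt; have -> : finv ph (iter i ph x) = iter i ph (finv ph x).
  by apply: ph_inj; rewrite f_finv // -iterS iterSr f_finv.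
rewrite bit_nth ?(pat_prev c x) ?rotK //.
by rewrite (order_face (_ : fc _ = fc x)) // -{2}(f_finv ph_inj x) fc_ph.
Qed.

(* Otherwise some face would have two of its neighbours equal. *)
Lemma weight2_separate c x : best c ->
  pat c x = [:: false; true; false; true; false; true] ->
  weight (pat c (al x)) = 2 -> weight (pat c (al (ph (ph x)))) = 2 ->
  forall y, fc y = fc (al (ph (ph x))) -> fc (al y) != fc (al x).
Proof.
move=> bc px /weight2E; set y1 := al x => P1 /weight2E; set y3 := al (ph (ph x)) => P3 y fy.
have vc := best_valid bc; have /validP[inv _] := vc.
have ox : order ph x = 6 by rewrite -(size_pat c) px.
have o1 : order ph y1 = 6 by rewrite -(size_pat c) P1.
have o3 : order ph y3 = 6 by rewrite -(size_pat c) P3.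
apply/eqP => /iter_face; rewrite o1 => -[i li ti].
have [j lj yj] := iter_face fy; rewrite o3 in lj.
have by1 : bit c y.
  have : bit c x = false by rewrite (@bit_nth c x 0) ?ox ?px.
  have : bit c (ph (ph x)) = false by rewrite (@bit_nth c x 2) ?ox ?px.
  rewrite /bit (inv (ph (ph x)) x) ?fc_ph // (inv _ _ fy) -/y1 -/y3 ti (inv (iter i ph y1) y1) ?fc_iter //.
  by do 3!case: (c _).
have := bits_across y vc; rewrite ti by1 yj !bit_iter_prev ?o1 ?o3 // !bit_iter_next ?o1 ?o3 // P1 P3.
have : nth false (pat c y1) i by rewrite -bit_nth ?o1 // -ti bit_al.
have : nth false (pat c y3) j by rewrite -bit_nth ?o3 // -yj.
rewrite P1 P3.
have lt6 k : k < 6 -> nth false [:: false; false; true; true; true; false] k ->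
   [\/ k = 2, k = 3 | k = 4].
  by case: k => [|[|[|[|[|[|k]]]]]] // _ _; constructor.
move=> /(lt6 j lj) jE /(lt6 i li) iE; move: ti yj.
(* The bits on either side of the common edge leave only the cases [i + j = 6]. *)
case: jE => ->; case: iE => -> ti yj [] // _ _.
- have [ne _ _] := far_nbrs (al (ph x)); apply: ne.
  by rewrite nbr_prev -/y3 nbr_second finv2_6 // -/y1 -ti alK.
- have [_ ne _] := far_nbrs (al (ph x)); apply: ne.
  rewrite -[RHS]nbr_second nbr_second !finv2_6 // -[iter 4 _ _]/(ph (iter 3 ph y1)) -ti.
  by rewrite yj -[iter 3 _ _]/(ph (iter 2 ph y3)) nbr_next.
- have e1 : fc (al (ph y1)) = fc (al (iter 5 ph x)).
    by rewrite -finv6 // /y1 -{1}(f_finv ph_inj x) nbr_next.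
  have e2 : fc (al (ph y1)) = fc (al (iter 3 ph x)).
    have -> : ph y1 = finv ph (al y) by rewrite ti /= finv_f.
    by rewrite nbr_prev yj -[ph _]/(iter 5 ph y3) -finv6 // nbr_prev.
  by have := @link_iter x 5 3; rewrite ox -e1 e2 => /(_ isT isT erefl).
Qed.

(* Otherwise recolour the two heavy faces (neutral), then the face of [x]. *)
Lemma weight2_apart c x : best c ->
  pat c x = [:: false; true; false; true; false; true] ->
  weight (pat c (al x)) = 2 -> weight (pat c (al (ph (ph x)))) = 2 -> False.
Proof.
move=> bc px w1 w3; have far := weight2_separate bc px w1 w3.
have P1 := weight2E w1; have P3 := weight2E w3.
have bc1 : best (flip (al x) c) by apply: best_flip; rewrite // P1.
have ox : order ph x = 6 by rewrite -(size_pat c) px.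
have P3' : pat (flip (al x) c) (al (ph (ph x))) = pat c (al (ph (ph x))).
  apply: pat_flip_far => //; apply/eqP => /(@link_iter x 2 0).
  by rewrite ox => /(_ isT isT).
have bc2 : best (flip (al (ph (ph x))) (flip (al x) c)).
  by apply: best_flip; rewrite // P3' P3.
have px1 : pat (flip (al x) c) x = [:: true; true; false; true; false; true].
  by rewrite pat_flip_near // px (@bit_nth c x 0) ?ox // px.
have px2 : pat (flip (al x) c) (ph (ph x)) = [:: false; true; false; true; true; true].
  by rewrite !pat_ph px1.
have := best_good (ph (ph x)) bc2.
rewrite pat_flip_near // px2.
by rewrite (@bit_nth _ (ph (ph x)) 0) ?px2 // (order_face (_ : _ = fc x)) ?fc_ph ?ox.
Qed.

(* Otherwise recolour the face across [ph x] (neutral), then that of [x]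
   (neutral), then the remaining heavy face; if the two heavy faces happen to be
   adjacent, some face would have two of its neighbours equal. *)
Lemma weight2_weight1_apart c x : best c ->
  pat c x = [:: true; false; true; false; false; false] ->
  weight (pat c (al (ph x))) = 2 -> weight (pat c (al (iter 4 ph x))) = 1 -> False.
Proof.
move=> bc px /weight2E; set y1 := al (ph x) => P1 /weight1E; set y4 := al (iter 4 ph x) => P4.
have vc := best_valid bc; have /validP[inv _] := vc.
have ox : order ph x = 6 by rewrite -(size_pat c) px.
have o1 : order ph y1 = 6 by rewrite -(size_pat c) P1.
have o4 : order ph y4 = 6.
  by rewrite -(size_pat c); move: P4; rewrite !inE => /or3P[]/eqP->.
have bx k : k < 6 -> bit c (iter k ph x) = nth false (pat c x) k.
  by rewrite -ox; apply: bit_nth.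
have bc1 : best (flip y1 c) by apply: best_flip; rewrite // P1.
have px1 : pat (flip y1 c) (ph x) = [:: true; true; false; false; false; true].
  by rewrite pat_flip_near // pat_ph px (bx 1) // px.
have bc2 : best (flip (ph x) (flip y1 c)) by apply: best_flip; rewrite // px1.
have f4 : fc (al y4) = fc (ph x) by rewrite alK fc_iter fc_ph.
have n14 : fc y4 != fc y1.
  by apply/eqP => /(@link_iter x 4 1); rewrite ox => /(_ isT isT).
have b4 : bit (flip y1 c) y4 = false.
  rewrite bit_flip f4 (negbTE n14) eq_sym (negbTE (no_self (ph x))) !addbF.
  by rewrite bit_al bx // px.
have good2 := best_good y4 bc2; rewrite pat_flip_near // b4 in good2.
have [/existsP[y /andP[/eqP fy /eqP fay]]|] :=
    boolP [exists y, (fc y == fc y4) && (fc (al y) == fc y1)]; last first.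
  rewrite negb_exists => /forallP none.
  move: good2; rewrite pat_flip_far //; last first.
    by move=> y fy; have := none y; rewrite fy eqxx.
  by move: P4; rewrite !inE => /or3P[]/eqP->.
have [i li yi] := iter_face fy; have [j lj tj] := iter_face fay; rewrite o4 in li; rewrite o1 in lj.
have by1 : bit c y.
  have : bit c (ph x) = false by rewrite (bx 1) ?px.
  have : bit c (iter 4 ph x) = false by rewrite (bx 4) ?px.
  rewrite /bit (inv (iter 4 ph x) x) ?fc_iter // (inv (ph x) x) ?fc_ph //.
  rewrite (inv _ _ fy) (inv _ _ fay) -/y1 -/y4.
  by do 3!case: (c _).
(* The first move turns the bit of the common edge, in position [i], to [false]. *)
have p1y4 : pat (flip y1 c) y4 = rotr i (false :: behead (rot i (pat c y4))).
  have -> : false :: behead (rot i (pat c y4)) = pat (flip y1 c) y.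
    by rewrite pat_flip_near // by1 yi pat_iter // o4 ltnW.
  by rewrite yi pat_iter ?o4 ?(ltnW li) // rotK.
rewrite {}p1y4 in good2.
have := bits_across y vc.
rewrite tj by1 yi !bit_iter_prev ?o1 ?o4 // !bit_iter_next ?o1 ?o4 // P1.
have : nth false (pat c y1) j by rewrite -bit_nth ?o1 // -tj bit_al.
have : nth false (pat c y4) i by rewrite -bit_nth ?o4 // -yi.
(* Beside its edge with [x], the face of [y4] borders neighbours 3 and 5 of [x], whereas [y1] is
   neighbour 1. *)
have near : (i = 1 -> False) /\ (i = 5 -> False).
  split=> iE; move: fay; rewrite yi iE.
    by rewrite (nbr_next (iter 3 ph x)) => /(@link_iter x 3 1); rewrite ox => /(_ isT isT).
  by rewrite -finv6 // nbr_prev => /(@link_iter x 5 1); rewrite ox => /(_ isT isT).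
have far : (i = 2 -> j = 3 -> False) /\ (i = 4 -> j = 3 -> False).
  split=> iE jE; move: yi tj; rewrite {}iE {}jE => yi tj.
    have [ne _ _] := far_nbrs (al (ph (ph x))); apply: ne.
    rewrite nbr_prev nbr_second finv2_6 // -/y1 -[iter 4 _ _]/(ph (iter 3 ph y1)) -tj yi.
    by rewrite -[iter 2 _ _]/(ph (ph y4)) nbr_next (nbr_next (iter 3 ph x)).
  have [_ _ ne] := far_nbrs (al x); apply: ne.
  rewrite -nbr_second -/y1; have -> : ph (ph (al (ph x))) = finv ph (al y) by rewrite tj /= finv_f.
  rewrite nbr_prev yi -[ph (iter 4 ph y4)]/(iter 5 ph y4) -finv6 // nbr_prev.
  rewrite -[ph (iter 4 ph x)]/(iter 5 ph x) -finv6 //.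
  by rewrite -{1}(f_finv ph_inj x) nbr_next.
rewrite P1; move: P4 good2 near far; rewrite !inE => /or3P[]/eqP->;
  move: i j li lj {yi tj} => [|[|[|[|[|[|i]]]]]] [|[|[|[|[|[|j]]]]]] // _ _ g [f1 f5] [f2 f4'] _ _ [];
  by [|move=> _ _; apply: f1|move=> _ _; apply: f5|move=> _ _; apply: f2|move=> _ _; apply: f4'].
Qed.

Lemma best_of_len c c' : best c -> valid c' -> len c' = len c -> best c'.
Proof.
move=> bc v E; rewrite /best v; apply/forallP => c2; apply/implyP => /(best_len bc).
by rewrite E.
Qed.

(** Recolouring the leaf loses four edges, and recolouring heavy neighbour [i] regains them. Away
    from its edge with that face, neighbour [j] sees one change: its edge towards [x] becomes
    like-coloured. *)
Lemma leaf_swap c x i j : best c ->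
  pat c x = [:: true; false; false; false; false; false] ->
  0 < i < 6 -> weight (pat c (al (iter i ph x))) = 1 ->
  0 < j < 6 -> weight (pat c (al (iter j ph x))) = 1 -> i != j ->
  let c2 := flip (al (iter i ph x)) (flip x c) in
  best c2 /\ forall k, k < 6 ->
    fc (al (iter k ph (al (iter j ph x)))) <> fc (al (iter i ph x)) ->
    bit c2 (iter k ph (al (iter j ph x))) =
      (k == 0) || nth false (pat c (al (iter j ph x))) k.
Proof.
move=> bc px /andP[i0 i6] /weight1E wi /andP[j0 j6] /weight1E wj nij c2.
have vc := best_valid bc.
have ox : order ph x = 6 by rewrite -(size_pat c) px.
have bx k : 0 < k < 6 -> bit c (iter k ph x) = false.
  by case/andP=> k0 k6; rewrite bit_nth ?ox // px; case: k k0 k6 => [|[|[|[|[|[|k]]]]]].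
have v1 : valid (flip x c) by apply: flip_run; rewrite ?px.
have near k : 0 < k < 6 -> pat (flip x c) (al (iter k ph x)) = true :: behead (pat c (al (iter k ph x))).
  by move=> k6; rewrite pat_flip_near ?bit_al ?bx // alK fc_iter.
have pi := near i; rewrite i0 i6 in pi; have {}pi := pi isT.
have v2 : valid c2.
  by apply: flip_run; rewrite // pi; move: wi; rewrite !inE => /or3P[]/eqP->.
have l1 := len_flip x c; have l2 := len_flip (al (iter i ph x)) (flip x c).
split.
  apply: (best_of_len bc v2); move: l1 l2; rewrite px pi /= -/c2.
  by move: wi; rewrite !inE => /or3P[]/eqP-> /=; clear; lia.
have oj : order ph (al (iter j ph x)) = 6.
  by rewrite -(size_pat c); move: wj; rewrite !inE => /or3P[]/eqP->.
move=> k k6 nk; rewrite bit_flip fc_iter.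
have -> : fc (al (iter j ph x)) == fc (al (iter i ph x)) = false.
  apply/eqP => /link_iter; rewrite ox => /(_ j6 i6) E.
  by rewrite E eqxx in nij.
rewrite (introF eqP nk) !addbF bit_nth ?oj // near ?j0 //.
by case: k {k6 nk} => //= k; rewrite nth_behead.
Qed.

(* Exchanging the leaf face of [x] with one of its heavy neighbours leaves an
   optimal colouring, whose patterns constrain the other heavy neighbours. *)
Lemma leaf_weights c x : best c ->
  pat c x = [:: true; false; false; false; false; false] ->
  weight (pat c (al (iter 2 ph x))) = 1 -> weight (pat c (al (iter 3 ph x))) = 1 ->
  weight (pat c (al (iter 4 ph x))) = 1 -> False.
Proof.
move=> bc px w2 w3 w4; have vc := best_valid bc.
have ox : order ph x = 6 by rewrite -(size_pat c) px.
have P2 := weight1E w2; have P3 := weight1E w3; have P4 := weight1E w4.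
have [b4 p4] := leaf_swap bc px (isT : 0 < 2 < 6) w2 (isT : 0 < 4 < 6) w4 isT.
have [b2 p2] := leaf_swap bc px (isT : 0 < 4 < 6) w4 (isT : 0 < 2 < 6) w2 isT.
set y2 := al (iter 2 ph x) in w2 P2 b4 p4 b2 p2 *.
set y3 := al (iter 3 ph x) in w3 P3 *.
set y4 := al (iter 4 ph x) in w4 P4 b4 p4 b2 p2 *.
have o2 : order ph y2 = 6 by rewrite -(size_pat c); move: P2; rewrite !inE => /or3P[]/eqP->.
have o3 : order ph y3 = 6 by rewrite -(size_pat c); move: P3; rewrite !inE => /or3P[]/eqP->.
have o4 : order ph y4 = 6 by rewrite -(size_pat c); move: P4; rewrite !inE => /or3P[]/eqP->.
have lx i j : i < 6 -> j < 6 -> fc (al (iter i ph x)) = fc (al (iter j ph x)) -> i = j.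
  by rewrite -{1 2}ox; apply: link_iter.
have l3 i j : i < 6 -> j < 6 -> fc (al (iter i ph y3)) = fc (al (iter j ph y3)) -> i = j.
  by rewrite -{1 2}o3; apply: link_iter.
(* Bits 1 and 5 are true in every word of weight 1, and the swap makes bit 0 true; a true bit [k]
   would then contradict [good]. *)
pose P k p := [&& size p == 6, nth false p 0, nth false p 1, nth false p k,
   nth false p 5 & has negb p] ==> ~~ good p.
have pure k : k \in [:: 2; 4] -> forall p, size p \in [:: 5; 6] -> P k p.
  by rewrite !inE => /orP[]/eqP-> ; apply: bit_seqs_complete; vm_compute.
have c4 : nth false (pat c y4) 2 = false.
  apply/negP => t; set c2 := flip _ _ in b4 p4.
  have := pure 2 isT _ (size_pat56 c2 y4); rewrite /P best_good // best_not_mono // size_pat o4 /=.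
  rewrite -!bit_nth ?o4 // !p4 //= ?t /=.
  - by move: P4; rewrite !inE => /or3P[]/eqP->.
  - rewrite -[ph (ph (ph (ph (ph y4))))]/(iter 5 ph y4) -finv6 // nbr_prev.
    by move/(lx 5 2 isT isT).
  - by rewrite (nbr_second (iter 3 ph x)) finv2_6 // -/y3 -(nbr_next (iter 2 ph x)) => /(l3 4 1 isT isT).
  - by rewrite (nbr_next (iter 3 ph x)) => /(lx 3 2 isT isT).
  - by move/eqP; rewrite alK eq_sym (fc_iter 4 x) -(fc_iter 2 x) (negbTE (no_self _)).
have c2 : nth false (pat c y2) 4 = false.
  apply/negP => t; set c2 := flip _ _ in b2 p2.
  have := pure 4 isT _ (size_pat56 c2 y2); rewrite /P best_good // best_not_mono // size_pat o2 /=.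
  rewrite -!bit_nth ?o2 // !p2 //= ?t /=.
  - by move: P2; rewrite !inE => /or3P[]/eqP->.
  - rewrite -[ph (ph (ph (ph (ph y2))))]/(iter 5 ph y2) -finv6 // nbr_prev.
    by move/(lx 3 4 isT isT).
  - rewrite -[ph (ph (ph (ph y2)))]/(iter 4 ph y2) -finv2_6 // -(nbr_second (iter 2 ph x)).
    by rewrite -(nbr_prev (iter 3 ph x)) finv6 // => /(l3 2 5 isT isT).
  - by rewrite (nbr_next (ph x)) => /(lx 1 4 isT isT).
  - by move/eqP; rewrite alK eq_sym (fc_iter 2 x) -(fc_iter 4 x) (negbTE (no_self _)).
(* Read on [y3], which borders both faces, the two facts make its bits 2 and 4 false; but a word of
   weight 1 has only one false bit besides the first. *)
move: c4; rewrite -bit_nth ?o4 //= -[ph y4]alK (prevE (iter 3 ph x)) -/y3.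
rewrite (bits_across _ vc) finv2_6 // finv6 // !bit_nth ?o3 //.
move: c2; rewrite -bit_nth ?o2 // -finv2_6 // -(prevE (iter 2 ph x)) -/y3.
rewrite (bits_across _ vc) (@bit_nth c y3 1) ?o3 // (@bit_nth c y3 2) ?o3 //.
by move: P3; rewrite !inE => /or3P[]/eqP->.
Qed.

(** * Discharging *)

Lemma face_order_sum d (g : D -> nat) :
  \sum_(y | fc y == fc d) g y = sumn (mkseq (fun i => g (iter i ph d)) (order ph d)).
Proof.
rewrite face_sum sumnE big_map.
have -> : orbit ph d = [seq iter i ph d | i <- iota 0 (order ph d)].
  by apply: (@eq_from_nth _ d) => [|i]; rewrite ?size_map size_orbit ?size_iota // => lt;
    rewrite (nth_map 0) ?size_iota // nth_iota // /orbit nth_traject.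
by rewrite big_map.
Qed.

Lemma face_rot_sum c d F : \sum_(y | fc y == fc d) F (pat c y) = rot_sum F (pat c d).
Proof.
rewrite face_order_sum /rot_sum size_pat !sumnE !big_map.
rewrite big_seq_cond [RHS]big_seq_cond; apply: eq_bigr => i.
by rewrite mem_iota add0n /= andbT => /ltnW lt; rewrite pat_iter.
Qed.

Lemma weight_cases c x : best c ->
  [\/ weight (pat c (al x)) = 0,
      weight (pat c (al x)) = 1 /\
        pat c x \in [:: [:: false; false; true; false; false; false];
                  [:: false; false; false; true; false; false];
                  [:: false; false; false; false; true; false];
                  [:: false; false; true; false; true; false]] |
      weight (pat c (al x)) = 2 /\
        pat c x \in [:: [:: false; true; false; true; false; true];
                  [:: false; true; false; false; false; true]]].
Proof.
move=> bc; have [w1|w1] := eqVneq (weight (pat c (al x))) 1.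
  by constructor 2; split=> //; apply: weight1_pat.
have [w2|w2] := eqVneq (weight (pat c (al x))) 2.
  by constructor 3; split=> //; apply: weight2_pat.
constructor 1; move: w1 w2; rewrite /weight; case: ifP => // _.
by case: (_ \in _).
Qed.

Lemma weight_received c x : best c -> weight (pat c (al x)) <= received (pat c x).
Proof.
move=> bc; rewrite /received; case: (weight_cases x bc) => [->|[-> E]|[-> E]] //.
  by rewrite E; case: ifP.
by rewrite E.
Qed.

(** For these three words [received] sums to 6, 3 and 3; [weight2_apart], [weight2_weight1_apart]
    and [leaf_weights] respectively exclude the excess. *)
Lemma face_received_le2 c x : best c ->
  pat c x \in [:: [:: false; true; false; true; false; true];
                  [:: true; false; true; false; false; false];
                  [:: true; false; false; false; false; false]] ->
  \sum_(y | fc y == fc x) weight (pat c (al y)) <= 2.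
Proof.
move=> bc px; have ox : order ph x = 6.
  by rewrite -(size_pat c); move: px; rewrite !inE => /or3P[]/eqP->.
have pi i : i < 6 -> pat c (iter i ph x) = rot i (pat c x).
  by move=> lt; rewrite pat_iter // ox ltnW.
have wi i : i < 6 -> weight (pat c (al (iter i ph x))) <= received (rot i (pat c x)).
  by move=> lt; rewrite -pi //; apply: weight_received.
rewrite face_order_sum ox.
move: px; rewrite !inE => /or3P[]/eqP px; rewrite px in wi pi.
- have h i : i < 6 -> weight (pat c (al (iter i ph x))) = 0 \/
      weight (pat c (al (iter i ph x))) = 2.
    move=> lt; case: (weight_cases (iter i ph x) bc) => [->|[_]|[-> _]]; [by left| |by right].
    by rewrite pi //; move: i lt => [|[|[|[|[|[|i]]]]]].
  have x6 : iter 6 ph x = x by rewrite -ox iter_order.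
  have n02 := weight2_apart bc px.
  have n24 := weight2_apart bc (pi 2 isT).
  have n40 := weight2_apart bc (pi 4 isT).
  rewrite -[ph (ph (iter 4 ph x))]/(iter 6 ph x) x6 in n40.
  have := wi 1 isT; have := wi 3 isT; have := wi 5 isT.
  rewrite /= !leqn0 => /eqP-> /eqP-> /eqP->.
  move: (h 0 isT) (h 2 isT) (h 4 isT) n02 n24 n40 => /=.
  do 3!move: (weight _); move=> w4 w2 w0.
  move=> [] -> [] -> [] -> // n02 n24 n40; by [case: n02|case: n24|case: n40].
- have n14 := weight2_weight1_apart bc px.
  have w1 : weight (pat c (al (iter 1 ph x))) <= 2 := wi 1 isT.
  have w4 : weight (pat c (al (iter 4 ph x))) <= 1 := wi 4 isT.
  have := wi 0 isT; have := wi 2 isT; have := wi 3 isT; have := wi 5 isT.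
  rewrite /= !leqn0 => /eqP-> /eqP-> /eqP-> /eqP->.
  move: w1 w4 n14 => /=; do 2!move: (weight _).
  by move=> [|[|b]] [|[|[|a]]] // _ _ /(_ erefl erefl).
- have nl := leaf_weights bc px.
  have w2 : weight (pat c (al (iter 2 ph x))) <= 1 := wi 2 isT.
  have w3 : weight (pat c (al (iter 3 ph x))) <= 1 := wi 3 isT.
  have w4 : weight (pat c (al (iter 4 ph x))) <= 1 := wi 4 isT.
  have := wi 0 isT; have := wi 1 isT; have := wi 5 isT.
  rewrite /= !leqn0 => /eqP-> /eqP-> /eqP->.
  move: w2 w3 w4 nl => /=; do 3!move: (weight _).
  by move=> [|[|a]] [|[|b]] [|[|e]] // _ _ _ /(_ erefl erefl erefl).
Qed.

(** In doubled units, a face accounts for at most one missed vertex once its incoming charge is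
    added and its outgoing charge subtracted. *)
Lemma face_balance c d : best c ->
  \sum_(y | fc y == fc d) ((lost (pat c y)).*2 + weight (pat c (al y))) <=
  2 + \sum_(y | fc y == fc d) weight (pat c y).
Proof.
move=> bc; rewrite big_split /=.
pose bad := [:: [:: false; true; false; true; false; true];
                  [:: true; false; true; false; false; false];
                  [:: true; false; false; false; false; false]].
pose P p := good p ==> has negb p ==>
  (rot_sum (fun p => (lost p).*2) p + rot_sum received p <= 2 + rot_sum weight p) ||
  [&& rot_sum (fun p => (lost p).*2) p == 0 &
      has (fun i => rot i p \in bad) (iota 0 (size p))].
have /(_ _ (size_pat56 c d)) : forall p, size p \in [:: 5; 6] -> P p.
  by apply: bit_seqs_complete; vm_compute.
rewrite /P best_good // best_not_mono //= => /orP[le|].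
  rewrite -(face_rot_sum c d (fun p => (lost p).*2)) -(face_rot_sum c d received) in le.
  rewrite -(face_rot_sum c d weight) in le.
  apply: leq_trans le; rewrite leq_add2l; apply: leq_sum => y _.
  exact: weight_received.
case/andP=> /eqP l0 /hasP[i]; rewrite mem_iota add0n size_pat => /andP[_ lt].
rewrite -pat_iter ?(ltnW lt) // => badi.
rewrite (face_rot_sum c d (fun p => (lost p).*2)) l0 -(fc_iter i d).
by apply: leq_trans (face_received_le2 bc badi) _; rewrite leq_addr.
Qed.

(** Summed over all faces, charge sent and charge received cancel. *)
Lemma lost_le_faces c : best c -> \sum_x lost (pat c x) <= #|Q|.
Proof.
move=> bc.
have : \sum_x ((lost (pat c x)).*2 + weight (pat c (al x))) <= \sum_(q : Q) 2 + \sum_x weight (pat c x).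
  rewrite (partition_big fc predT) // [X in _ <= _ + X](partition_big fc predT) //= -big_split /=.
  apply: leq_sum => q _; have [d /eqP <-|none] := pickP (fun d => fc d == q).
    exact: face_balance.
  by rewrite big_pred0.
have -> : \sum_x weight (pat c x) = \sum_x weight (pat c (al x)).
  by rewrite (reindex_inj (inv_inj alK)).
rewrite big_split /=.
by rewrite leq_add2r sum_nat_const muln2 -(big_morph _ doubleD double0) leq_double.
Qed.

(** * Counting the vertices on the border *)

Definition border c := [set x | c x && ~~ c (al x)].

(** The darts [al x], [ph x] and [ph (al (ph x))] leave the vertex at which [x] points. Exactly one
    of them is in the border, unless the three faces there share a colour. *)
Lemma card_darts c : valid c -> #|D| = \sum_x lost (pat c x) + 3 * #|border c|.
Proof.
move=> vc; have /validP[inv _] := vc.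
have bsum (f : D -> D) : injective f -> #|border c| = \sum_x (f x \in border c : nat).
  move=> fi; rewrite -sum1_card big_mkcond (reindex_inj fi).
  by apply: eq_bigr => x _; case: (_ \in _).
have -> : 3 * #|border c| = #|border c| + #|border c| + #|border c| by lia.
rewrite {1}(bsum al (inv_inj alK)) {1}(bsum ph ph_inj) (bsum (ph \o al \o ph)); last first.
  exact: inj_comp (inj_comp ph_inj (inv_inj alK)) ph_inj.
rewrite -!big_split -sum1_card /=; apply: eq_big => // x _.
rewrite /border !inE alK (inv _ _ (nbr_next x)) (inv _ _ (fc_ph x)) (inv _ _ (fc_ph (al (ph x)))).
have o1 : 1 < order ph x by have := deg56 x; rewrite !inE => /orP[]/eqP->.
rewrite /lost !nth_pat ?order_gt0 // /bit /= (inv _ _ (fc_ph x)).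
by case: (c x); case: (c (al x)); case: (c (al (ph x))).
Qed.

Lemma best_exists : exists c, best c.
Proof.
have [c vc mx] := arg_maxnP len constant_valid; exists c; rewrite /best vc.
by apply/forallP => c'; apply/implyP; apply: mx.
Qed.

Lemma long_border : D -> exists c, [/\ valid c, border c != set0 &
  #|D| <= #|Q| + 3 * #|border c|].
Proof.
move=> x; have [c bc] := best_exists; have vc := best_valid bc.
exists c; split=> //; last by rewrite (card_darts vc) leq_add2r lost_le_faces.
have [z] := best_nontrivial x bc; rewrite /bit => nz; apply/set0Pn.
have [cz|cz] := boolP (c z); [exists z|exists (al z)]; rewrite !inE ?alK.
  by move: nz; rewrite cz; case: (c (al z)).
by move: nz; rewrite (negbTE cz) andbT; case: (c (al z)).
Qed.

End Core.

(** * From the rotation system to a map of darts *)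

Section PlaneGraph.
Variables (V : finType) (e : rel V) (rho : V -> V -> V).
Hypothesis e_sym : symmetric e.
Hypothesis e_irr : irreflexive e.
Hypothesis e_cubic : cubic e.
Hypothesis e_conn3 : three_connected e.
Hypothesis rhoP : rotation_system e rho.
Hypothesis rho_genus0 : #|V| + #|faces e rho| = nedges e + 2.
Hypothesis face_size : forall d, d \in darts e -> #|face_of rho d| \in [:: 5; 6].

Lemma rho_nbr v u : e v u -> e v (rho v u).
Proof. by have [+ _] := rhoP v => /(_ u); rewrite !inE. Qed.

Lemma rho_closed v u (S : {set V}) : e v u -> u \in S ->
  (forall w, w \in S -> rho v w \in S) -> nbr e v \subset S.
Proof.
move=> evu uS clo; apply/subsetP => w wn.
have [_ /(_ u w)] := rhoP v; rewrite inE evu => /(_ isT wn) /iter_findex <-.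
by elim: (findex _ _ _) => //= n IH; apply: clo.
Qed.

(** By transitivity [w] is reached from [rho v w], so every neighbour is an image; a surjection of a
    finite set onto itself is injective. *)
Lemma rho_inj v : {in nbr e v &, injective (rho v)}.
Proof.
apply/imset_injP; rewrite eqn_leq leq_imset_card /=.
apply/subset_leq_card/subsetP => w wn.
have rw : rho v w \in nbr e v by rewrite inE rho_nbr // -inE; move: wn; rewrite !inE.
have [clo /(_ _ _ rw wn) /iter_findex E] := rhoP v.
rewrite -{}E -iterSr /=; apply: imset_f.
by elim: (findex _ _ _) => //= n IH; apply: clo.
Qed.

Lemma rho3 v u : e v u -> rho v (rho v (rho v u)) = u /\
  nbr e v = [set u; rho v u; rho v (rho v u)].
Proof.
move=> evu; have e1 := rho_nbr evu; have e2 := rho_nbr e1; have e3 := rho_nbr e2.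
have inj x y : e v x -> e v y -> rho v x = rho v y -> x = y.
  by move=> ex ey; apply: rho_inj; rewrite inE.
have sub (S : {set V}) : u \in S -> (forall w, w \in S -> rho v w \in S) -> 2 < #|S|.
  by move=> uS clo; rewrite -(e_cubic v); apply/subset_leq_card/(rho_closed evu uS).
have n01 : rho v u != u.
  apply/eqP => E; have /(_ (set11 u)) := sub [set u]; rewrite cards1 => H.
  by suff : 2 < 1 by []; apply: H => w; rewrite inE => /eqP ->; rewrite E set11.
have n02 : rho v (rho v u) != u.
  apply/eqP => E; have /(_ (set21 _ _)) := sub [set u; rho v u]; rewrite cards2 => H.
  suff : 2 < (u != rho v u).+1 by case: (_ != _).
  by apply: H => w; rewrite !inE => /orP[] /eqP ->; rewrite ?E ?eqxx ?orbT.
have n12 : rho v (rho v u) != rho v u by apply: contra n01 => /eqP/inj ->.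
have nE : nbr e v = [set u; rho v u; rho v (rho v u)].
  apply/esym/eqP; rewrite eqEcard e_cubic; apply/andP; split.
    by apply/subsetP => w; rewrite !inE => /orP[/orP[]|] /eqP ->.
  by rewrite setUC cardsU1 cards2 !inE negb_or n02 n12 (eq_sym u) n01.
split=> //; have : rho v (rho v (rho v u)) \in nbr e v by rewrite inE.
rewrite nE !inE => /orP[/orP[/eqP //|/eqP/inj E]|/eqP/inj E].
  by rewrite E ?eqxx in n02.
by rewrite E ?eqxx // in n12.
Qed.

(** A subtype, since [face_succ] is controlled only on pairs that are edges. *)
Definition dart := {d : V * V | d \in darts e}.
Definition ends (x : dart) : V * V := sval x.
Definition tail (x : dart) := (ends x).1.
Definition head (x : dart) := (ends x).2.

Lemma ends_dart x : ends x \in darts e.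
Proof. exact: (svalP x). Qed.

Lemma ends_inj : injective ends.
Proof. exact: val_inj. Qed.

Lemma dart_edge x : e (tail x) (head x).
Proof. by have := ends_dart x; rewrite inE. Qed.

Lemma rev_proof x : (head x, tail x) \in darts e.
Proof. by rewrite inE /= e_sym dart_edge. Qed.
Definition rev x : dart := exist _ (head x, tail x) (rev_proof x).

Lemma next_proof x : face_succ rho (ends x) \in darts e.
Proof. by rewrite inE /= rho_nbr // e_sym dart_edge. Qed.
Definition next x : dart := exist _ (face_succ rho (ends x)) (next_proof x).

Lemma dartE x y : tail x = tail y -> head x = head y -> x = y.
Proof.
rewrite /tail /head => E1 E2; apply: ends_inj.
by rewrite [LHS]surjective_pairing E1 E2 -surjective_pairing.
Qed.

Lemma revK : involutive rev.
Proof. by move=> x; apply: dartE. Qed.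

Lemma rev_neq x : rev x != x.
Proof.
apply/eqP => /(congr1 tail) E; have := dart_edge x.
by rewrite -[head x]/(tail (rev x)) E e_irr.
Qed.

Lemma next_inj : injective next.
Proof.
move=> x y E; have h : head x = head y by exact: (congr1 tail E).
apply: dartE => //; apply: (@rho_inj (head x)); rewrite ?inE.
- by rewrite e_sym dart_edge.
- by rewrite h e_sym dart_edge.
- by have := congr1 head E; rewrite /head /= -/(head y) -h.
Qed.

Lemma next_tri z : next (rev (next (rev (next z)))) = rev z.
Proof.
apply: dartE => //=; have := dart_edge z; rewrite e_sym => /rho3[].
by rewrite /head /tail /=.
Qed.

Definition turn x := next (rev x).

Lemma turn_inj : injective turn.
Proof. by move=> x y /next_inj/(inv_inj revK). Qed.

Lemma tail_turn x : tail (turn x) = tail x.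
Proof. by []. Qed.

Lemma turn3 x : turn (turn (turn x)) = x.
Proof. by apply: dartE => //; have [] := rho3 (dart_edge x). Qed.

Lemma turn_cases x y : tail x = tail y -> [\/ y = x, y = turn x | y = turn (turn x)].
Proof.
move=> E; have [_ nE] := rho3 (dart_edge x).
have : head y \in nbr e (tail x) by rewrite inE E dart_edge.
rewrite nE !inE => /orP[/orP[]|] /eqP hE;
  [constructor 1|constructor 2|constructor 3]; apply: dartE; by rewrite // -E.
Qed.

Lemma turn_connect (r : rel dart) : (forall x, r x (turn x)) ->
  forall x y, tail x = tail y -> connect r x y.
Proof.
move=> rt x y /turn_cases[] ->; first exact: connect0.
  exact: connect1.
by apply: connect_trans (connect1 (rt _)); apply: connect1.
Qed.

Lemma vertex_const (h : V -> bool) :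
  (forall d, h (tail d) = h (tail (rev d))) -> forall a b, h a = h b.
Proof.
move=> hd a b; have [_ /(_ set0)] := e_conn3; rewrite cards0 => /(_ isT a b).
rewrite !in_set0 => /(_ isT isT) /connectP[p pth ->].
elim: p a pth => //= w p IH a /andP[/andP[eaw _] pth]; rewrite -(IH w pth).
have aw : (a, w) \in darts e by rewrite inE.
exact: (hd (exist _ (a, w) aw)).
Qed.

Lemma next_iter n x : ends (iter n next x) = iter n (face_succ rho) (ends x).
Proof. by elim: n => //= n ->. Qed.

Lemma face_ofE x : face_of rho (ends x) = [set ends y | y in fconnect next x].
Proof.
apply/setP => d; rewrite inE; apply/idP/idP => [/iter_findex <-|/imsetP[y]].
  by rewrite -next_iter; apply: imset_f; apply: fconnect_iter.
by move/iter_findex => <- ->; rewrite next_iter fconnect_iter.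
Qed.

Definition face_type := {f : {set V * V} | f \in faces e rho}.

Lemma face_proof x : face_of rho (ends x) \in faces e rho.
Proof. by apply: imset_f; exact: ends_dart. Qed.
Definition face x : face_type := exist _ (face_of rho (ends x)) (face_proof x).

Lemma faceP x y : (face x == face y) = fconnect next x y.
Proof.
rewrite -(inj_eq val_inj) /= !face_ofE; apply/eqP/idP => [E|xy].
  have : ends y \in [set ends z | z in fconnect next y] by apply: imset_f; apply: connect0.
  by rewrite -E => /imsetP[z xz /ends_inj ->].
have xyE : fconnect next x =1 fconnect next y.
  exact: (same_connect (fconnect_sym next_inj) xy).
apply/setP => d; apply/imsetP/imsetP => -[z xz ->]; exists z => //.
  by rewrite -topredE /= -xyE.
by rewrite -topredE /= xyE.
Qed.

Lemma order_next x : order next x \in [:: 5; 6].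
Proof.
rewrite (_ : order next x = #|face_of rho (ends x)|) ?face_size ?ends_dart //.
by rewrite face_ofE card_imset //; apply: ends_inj.
Qed.

Lemma dart_connect x y : connect [rel x y | (face x == face y) || (y == rev x)] x y.
Proof.
set r := [rel x y | _].
have rr z : connect r z (rev z) by apply: connect1; rewrite /= eqxx orbT.
have rn z : connect r z (next z).
  by apply: connect1; rewrite /= faceP fconnect1.
have rt u z : tail u = tail z -> connect r u z.
  move=> uz; have : connect (connect r) u z.
    by apply: turn_connect uz => w; apply: connect_trans (rr w) (rn _).
  by apply: connect_sub => ? ?.
have /connectP[p pth E] : connect (fun a b => e a b && (b \notin set0)) (tail x) (tail y).
  by have [_ /(_ set0)] := e_conn3; rewrite cards0 => /(_ isT); apply; rewrite in_set0.
elim: p x pth E => [|w p IH] x /= pth E; first by apply: rt; rewrite E.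
case/andP: pth => /andP[exw _] pth.
have xw : (tail x, w) \in darts e by rewrite inE.
pose d : dart := exist _ (tail x, w) xw.
apply: (@connect_trans _ _ d); first exact: rt.
by apply: connect_trans (rr d) _; apply: IH.
Qed.

Lemma face_const (h : face_type -> bool) :
  (forall d, h (face d) = h (face (rev d))) -> forall a b, h a = h b.
Proof.
move=> hd a b.
have rep (f : face_type) : exists x, f = face x.
  case: f => f ff; have /imsetP[d dd fE] := ff.
  by exists (exist _ d dd); apply: val_inj.
have [x ->] := rep a; have [y ->] := rep b.
have /connectP[p pth ->] := dart_connect x y.
elim: p x pth => //= w p IH x /andP[xw pth]; rewrite -(IH w pth).
by case/orP: xw => [/eqP ->|/eqP ->].
Qed.

Lemma card_out v : #|[set x | tail x == v]| = 3.
Proof.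
rewrite -(e_cubic v) -(@card_in_imset _ _ head) => [|x y]; last first.
  by rewrite !inE => /eqP <- /eqP E; apply: dartE.
apply: eq_card => u; rewrite inE; apply/imsetP/idP => [[x]|evu].
  by rewrite inE => /eqP <- ->; rewrite dart_edge.
have vu : (v, u) \in darts e by rewrite inE.
by exists (exist _ (v, u) vu); rewrite ?inE.
Qed.

Lemma card_dart : #|{: dart}| = 3 * #|V|.
Proof.
rewrite -sum1_card (partition_big tail predT) //= mulnC -sum_nat_const.
by apply: eq_bigr => v _; rewrite sum1dep_card card_out.
Qed.

(** [nedges] is a floored half; [card_forward] makes the division exact. *)
Lemma plane_euler : 2 * (#|V| + #|{: face_type}|) = #|{: dart}| + 4.
Proof.
have cf : #|{: face_type}| = #|faces e rho| by rewrite card_sig; apply: eq_card.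
have cd : #|{: dart}| = #|darts e| by rewrite card_sig; apply: eq_card.
have := card_forward revK rev_neq; rewrite cf rho_genus0 /nedges -cd => ->.
by rewrite mulKn // mulnDr.
Qed.

(** [turn] keeps the tail and moves the face across a dart to its own side, so the two counts are
    equal. *)
Lemma even_vertex_face a b :
  ~~ odd (#|[set d | (tail d == a) && (face d == b)]| +
          #|[set d | (tail d == a) && (face (rev d) == b)]|).
Proof.
have -> : #|[set d | (tail d == a) && (face (rev d) == b)]| =
          #|[set d | (tail d == a) && (face d == b)]|.
  rewrite -(card_imset _ turn_inj); apply: eq_card => d; apply/imsetP/idP => [[d']|].
    rewrite !inE => /andP[ta fb] ->; rewrite tail_turn ta -(eqP fb) eq_sym /=.
    by rewrite faceP fconnect1.
  rewrite !inE => /andP[ta fb]; exists (turn (turn d)); last by rewrite turn3.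
  rewrite inE !tail_turn ta -(eqP fb) /= faceP.
  by rewrite -{2}(turn3 d) fconnect1.
by rewrite addnn odd_double.
Qed.

Lemma even_face_vertex b a :
  ~~ odd (#|[set d | (face d == b) && (tail d == a)]| +
          #|[set d | (face d == b) && (tail (rev d) == a)]|).
Proof.
have -> : #|[set d | (face d == b) && (tail d == a)]| =
          #|[set d | (face d == b) && (tail (rev d) == a)]|.
  rewrite -[RHS](card_imset _ next_inj); apply: eq_card => d; apply/idP/imsetP => [|[d']].
    rewrite !inE => /andP[fb ta]; exists (finv next d); last by rewrite f_finv //; apply: next_inj.
    rewrite inE -(eqP ta) -{3}(f_finv next_inj d) eqxx andbT -(eqP fb) faceP.
    by rewrite -{2}(f_finv next_inj d) fconnect1.
  rewrite !inE => /andP[fb ta] ->; rewrite ta andbT -(eqP fb) eq_sym faceP.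
  exact: fconnect1.
by rewrite addnn odd_double.
Qed.

Lemma cycle_is_face_cut (z : dart -> bool) : (forall d, z (rev d) = z d) ->
  (forall a, ~~ odd #|[set d | (tail d == a) && z d]|) ->
  exists h : face_type -> bool, forall d, z d = h (face d) (+) h (face (rev d)).
Proof.
apply: (cocycle_is_coboundary revK rev_neq vertex_const face_const).
  exact: plane_euler.
exact: even_vertex_face.
Qed.

Lemma dual_cycle_is_cut (z : dart -> bool) : (forall d, z (rev d) = z d) ->
  (forall f, ~~ odd #|[set d | (face d == f) && z d]|) ->
  exists h : V -> bool, forall d, z d = h (tail d) (+) h (head d).
Proof.
apply: (cocycle_is_coboundary revK rev_neq face_const vertex_const).
  by rewrite addnC plane_euler.
exact: even_face_vertex.
Qed.

(** * Small cuts and 3-connectivity *)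

(** Deleting the end of [x] on one side and the end of [y] on the other destroys both cut edges,
    while degree three leaves a vertex on each side. The case [x = y] covers bridges. *)
Lemma no_two_edge_cut (h : V -> bool) (x y : dart) :
  ~ (forall d, (d \in [:: x; rev x; y; rev y]) = h (tail d) (+) h (head d)).
Proof.
move=> cut.
wlog hx : x y cut / h (tail x).
  move=> W; case: (boolP (h (tail x))) => [/(W x y cut) //|nx].
  apply: (W (rev x) y) => [d|].
    by rewrite -cut revK !inE orbCA.
  by have := cut x; rewrite inE eqxx (negbTE nx).
wlog hy : y cut / h (tail y).
  move=> W; case: (boolP (h (tail y))) => [/(W y cut) //|ny].
  apply: (W (rev y)) => [d|].
    by rewrite -cut revK !inE; congr (_ || (_ || _)); rewrite orbC.
  by have := cut y; rewrite !inE eqxx !orbT (negbTE ny).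
have hx' : h (head x) = false.
  by have := cut x; rewrite inE eqxx hx; case: (h (head x)).
have hy' : h (head y) = false.
  by have := cut y; rewrite !inE eqxx !orbT hy; case: (h (head y)).
have crossing v u : e v u -> h v -> ~~ h u -> (v, u) = ends x \/ (v, u) = ends y.
  move=> evu hv hu; have vu : (v, u) \in darts e by rewrite inE.
  have := cut (exist _ (v, u) vu); rewrite /tail /head /= hv (negbTE hu) !inE.
  case/or4P => /eqP E; [by left; rewrite -E| |by right; rewrite -E|].
    by move: hv; rewrite (_ : v = head x) ?hx' //; exact: (congr1 tail E).
  by move: hv; rewrite (_ : v = head y) ?hy' //; exact: (congr1 tail E).
have third v p q : exists2 u, e v u & u \notin [:: p; q].
  have : 0 < #|nbr e v :\: [set p; q]|.
    have := cardsID [set p; q] (nbr e v); rewrite e_cubic.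
    have : #|nbr e v :&: [set p; q]| <= 2.
      by apply: leq_trans (subset_leq_card (subsetIr _ _)) _; rewrite cards2; case: (_ != _).
    lia.
  by case/card_gt0P => u; rewrite !inE => /andP[nu vu]; exists u; rewrite ?inE.
(* A neighbour of [tail x] avoiding both heads is not reached by a cut edge, so it lies on the side
   of [tail x]; similarly for [w]. *)
have [u eu nu] := third (tail x) (head x) (head y).
have [w ew nw] := third (head y) (tail x) (tail y).
have hu : h u.
  apply/negPn/negP => hu; have [E|E] := crossing _ _ eu hx hu;
    by have := congr1 snd E; move: nu; rewrite !inE /= => nu E'; rewrite E' ?eqxx ?orbT in nu.
have hw : h w = false.
  apply/negbTE/negP => hw; have : e w (head y) by rewrite e_sym.
  move/crossing => /(_ hw); rewrite hy' => -[] // E;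
    by have := congr1 fst E; move: nw; rewrite !inE /= => nw E'; rewrite E' ?eqxx ?orbT in nw.
have [_ /(_ [set tail x; head y])] := e_conn3.
rewrite cards2 => /(_ _ u w); case: (_ != _) => /(_ isT).
all: rewrite !inE; case: eqP => [E|_]; first by rewrite E e_irr in eu.
all: case: eqP => [E|_]; first by rewrite -E hu in hy'.
all: case: eqP => [E|_]; first by rewrite E hx in hw.
all: case: eqP => [E|_]; first by rewrite E e_irr in ew.
all: move=> /(_ isT isT) /connectP[p pth wE].
all: have ux : u != tail x by apply: contraTneq eu => ->; rewrite e_irr.
all: have uy : u != head y by apply: contraTneq hu => ->; rewrite hy'.
all: rewrite {}wE in hw.
all: elim: p u {eu nu} hu ux uy pth hw => [|v p IH] u hu ux uy /=; first by rewrite hu.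
all: case/andP=> /andP[euv]; rewrite !inE negb_or => /andP[vx vy] pth hl.
all: have [hv|hv] := boolP (h v); first exact: (IH v).
all: case: (crossing _ _ euv hu hv) => E.
all: by [have := congr1 fst E => /= E'; rewrite E' eqxx in ux
        |have := congr1 snd E => /= E'; rewrite E' eqxx in vy].
Qed.

Lemma card_count (T : finType) (a : pred T) (l : seq T) : uniq l ->
  #|[set d | a d && (d \in l)]| = count a l.
Proof.
move=> Ul; rewrite -size_filter -(card_uniqP (filter_uniq a Ul)).
by apply: eq_card => d; rewrite inE mem_filter.
Qed.

(** Such an edge would be a dual loop, hence a cut of one edge. *)
Lemma face_rev_neq x : face (rev x) != face x.
Proof.
apply/eqP => E.
have [d|f|h hE] := @dual_cycle_is_cut (mem [:: x; rev x]).
- by rewrite !inE (can2_eq revK revK) (inj_eq (inv_inj revK)) orbC.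
- rewrite card_count /= ?E ?inE ?andbT; last by rewrite eq_sym rev_neq.
  by case: (_ == f).
apply: (@no_two_edge_cut h x x) => d; rewrite -hE !inE.
by case: (d == x); case: (d == rev x).
Qed.

(** Two such edges would form a dual digon, hence a cut of two edges. *)
Lemma face_link_inj x y : face x = face y -> face (rev x) = face (rev y) -> x = y.
Proof.
move=> E E'; apply/eqP/negPn/negP => nxy.
have nxry : x != rev y by apply: contra_neq (face_rev_neq y) => <-.
have [d|f|h hE] := @dual_cycle_is_cut (mem [:: x; rev x; y; rev y]).
- rewrite !inE !(can2_eq revK revK) !revK.
  by case: (d == x); case: (d == y); case: (d == rev x); case: (d == rev y).
- rewrite card_count /= ?E ?E' ?inE; last first.
    rewrite !negb_or nxy nxry eq_sym rev_neq /= (can2_eq revK revK) nxry.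
    by rewrite (inj_eq (inv_inj revK)) nxy eq_sym rev_neq.
  by do 2!case: (_ == f).
exact: (@no_two_edge_cut h x y).
Qed.

(** * The bichromatic edges form a single cycle *)

Section BorderCycle.
Variable c : {ffun dart -> bool}.
Hypothesis c_face : forall x y, face x = face y -> c x = c y.
Hypothesis c_conn : forall x y, c x = c y -> connect (same_side rev face c) x y.

Let B := border rev c.

Lemma face_next x : face (next x) = face x.
Proof. by apply/eqP; rewrite eq_sym faceP fconnect1. Qed.

Lemma c_turn x : c (turn x) = c (rev x).
Proof. by apply: c_face; rewrite face_next. Qed.

(** Going round a vertex of degree three, the colour changes from [k] to [~~ k] at most once.
    [k = true] handles border darts leaving a vertex, [k = false] those entering it. *)
Lemma out_unique k x y : tail x = tail y ->
  c x = k -> c (rev x) = ~~ k -> c y = k -> c (rev y) = ~~ k -> x = y.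
Proof.
case/turn_cases => -> // cx crx.
  by rewrite c_turn crx; case: k {cx crx}.
by rewrite -[c (rev _)]c_turn turn3 cx; case: k {cx crx}.
Qed.

Lemma B_tail_inj : {in B &, injective tail}.
Proof.
move=> x y; rewrite !inE => /andP[cx crx] /andP[cy cry] E.
by apply: (@out_unique true); rewrite //; apply/negbTE.
Qed.

(** The border is followed with colour [true] kept on the side of the dart. The identity outside [B]
    makes [step] a permutation of all darts. *)
Definition step x :=
  if x \in B then if c (rev (next x)) then turn (next x) else next x else x.

Lemma step_B x : (step x \in B) = (x \in B).
Proof.
rewrite /step; case: ifP => // xB; have := xB; rewrite inE => /andP[cx crx].
have cn : c (next x) = c x by apply: c_face; rewrite face_next.
case: ifP => cr; rewrite inE ?cn ?cx ?cr //.
rewrite c_turn cr -[c (rev _)]c_turn.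
by rewrite -[next x](_ : turn (rev x) = _) ?turn3 // /turn revK.
Qed.

Lemma tail_step x : x \in B -> tail (step x) = head x.
Proof. by rewrite /step => ->; case: ifP. Qed.

Lemma step_inj : injective step.
Proof.
move=> x y E; have xyB : (x \in B) = (y \in B) by rewrite -step_B E step_B.
have [xB|xB] := boolP (x \in B); last by move: E; rewrite /step -xyB (negbTE xB).
have yB := xB; rewrite xyB in yB.
have : head x = head y by rewrite -!tail_step // E.
move: xB yB; rewrite !inE => /andP[cx crx] /andP[cy cry] hE.
by apply: (inv_inj revK); apply: (@out_unique false); rewrite ?revK //; apply: negbTE.
Qed.

Lemma B_orbit x y : x \in B -> fconnect step x y -> y \in B.
Proof. by move=> xB /iter_findex <-; elim: (findex _ _ _) => //= n; rewrite step_B. Qed.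

(* The orbit of [x] is a cycle, hence the boundary of a set of faces; as both
   colour classes are connected, this set is one of them. *)
Lemma B_one_orbit x y : x \in B -> y \in B -> fconnect step x y.
Proof.
move=> xB yB; pose O d := fconnect step x d.
have OB d : O d -> d \in B by apply: B_orbit.
have B1 d : d \in B -> rev d \notin B.
  by rewrite !inE revK => /andP[-> _]; rewrite andbF.
have [d|a|h hE] := @cycle_is_face_cut (fun d => O d || O (rev d)).
- by rewrite revK orbC.
- suff -> : #|[set d | (tail d == a) && (O d || O (rev d))]| =
            (#|[set d | (head d == a) && O d]|).*2 by rewrite odd_double.
  have E1 : #|[set d | (head d == a) && O d]| = #|[set d | (tail d == a) && O d]|.
    rewrite !card_sum_bool [RHS](reindex_inj step_inj); apply: eq_bigr => d _ /=.
    have OE : O (step d) = O d by rewrite /O -(same_fconnect1_r step_inj).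
    by rewrite OE; case Od : (O d); rewrite ?andbF // tail_step ?OB.
  have E2 : #|[set d | (head d == a) && O d]| = #|[set d | (tail d == a) && O (rev d)]|.
    by rewrite !card_sum_bool (reindex_inj (inv_inj revK)).
  rewrite -addnn {1}E1 E2 !card_sum_bool -big_split; apply: eq_bigr => d _ /=.
  case: (tail d == a) => //=; case Od : (O d) => //=.
  by case: (boolP (O (rev d))) => // /OB; rewrite (negbTE (B1 _ (OB _ Od))).
(* An edge between like-coloured faces is not in the orbit, so [h] does not change across it. *)
have hconst u v : c u = c v -> h (face u) = h (face v).
  move=> /c_conn /connectP[p pth ->]; elim: p u pth => //= w p IH u.
  case/andP=> /andP[/eqP cuw uw] pth; rewrite -(IH w pth).
  case/orP: uw => [/eqP -> //|/eqP wE].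
  have nB d : c d = c (rev d) -> d \notin B by rewrite inE => <-; rewrite andbN.
  have := hE u; rewrite -wE.
  have -> : O u = false by apply/negP => /OB; rewrite (negbTE (nB u _)) // -wE.
  have -> : O w = false by apply/negP => /OB; rewrite (negbTE (nB w _)) // wE revK -wE.
  by case: (h (face u)); case: (h (face w)).
have cB d : d \in B -> c d = true /\ c (rev d) = false.
  by rewrite inE => /andP[-> /negbTE].
have [cx crx] := cB x xB; have [cy cry] := cB y yB.
(* The edge of [y] separates the same two classes as that of [x], and [h] differs on them, so [y] is
   in the orbit too. *)
have := hE y; rewrite (hconst y x) ?cx // (hconst (rev y) (rev x)) ?crx // -hE.
have -> : O (rev y) = false by apply/negP => /OB; rewrite (negbTE (B1 _ yB)).
by rewrite orbF -/(O y) => ->; rewrite {1}/O connect0.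
Qed.

Lemma border_cycle x : x \in B -> exists p : seq V,
  [/\ uniq p, cycle e p & size p = #|B|].
Proof.
move=> xB; exists [seq tail y | y <- orbit step x].
have inB y : y \in orbit step x -> y \in B.
  by rewrite -fconnect_orbit; apply: B_orbit.
split.
- rewrite map_inj_in_uniq ?orbit_uniq // => y z /inB yB /inB zB; exact: B_tail_inj.
- rewrite cycle_map; have /allP allB : {subset orbit step x <= mem B} := inB.
  apply: (sub_in_cycle _ allB (cycle_orbit step_inj x)) => y z yB _ /eqP <- /=.
  by rewrite tail_step // dart_edge.
- rewrite size_map size_orbit; apply: eq_card => y.
  by apply/idP/idP => [/(B_orbit xB)|/(B_one_orbit xB)].
Qed.

End BorderCycle.

Lemma plane_long_cycle :
  exists p : seq V, is_cycle e p /\ 5 * #|V| <= 6 * size p + 4.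
Proof.
have V3 : 3 < #|V| by case: e_conn3.
have /card_gt0P[v _] : 0 < #|V| by apply: leq_trans V3.
have /card_gt0P[x _] : 0 < #|[set x | tail x == v]| by rewrite card_out.
have [c [vc /set0Pn[y yB] le]] := long_border revK next_inj faceP next_tri order_next
  face_link_inj face_rev_neq dart_connect x.
have /(validP rev faceP)[c_face c_conn] := vc.
have [p [Up Cp szp]] := border_cycle c_face c_conn yB.
have bound : 5 * #|V| <= 6 * size p + 4.
  have {}le : #|{: dart}| <= #|{: face_type}| + 3 * size p by rewrite szp.
  by move: le plane_euler; rewrite card_dart; clear; lia.
exists p; split=> //; rewrite /is_cycle Up Cp andbT /=.
(* With at least four vertices the bound reads [16 <= 6 * size p], so the length is at least
   three. *)
by move: V3 bound; clear; lia.
Qed.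

End PlaneGraph.

Theorem theorem11 (V : finType) (e : rel V) :
  fullerene e ->
  exists p : seq V, is_cycle e p /\ 5 * #|V| <= 6 * size p + 4.
Proof.
case=> [[e_sym e_irr] e_cubic e_conn3 [rho [[rhoP genus0] face_size]]].
exact: (plane_long_cycle e_sym e_irr e_cubic e_conn3 rhoP genus0 face_size).
Qed.
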